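(* Let $p \geq 2$, $x_0 \in \mathbb{R}^d$, and let $f$ be a non-negative function of class $C^p$ defined on an open neighborhood of $x_0$ in $\mathbb{R}^d$ with $f(x_0)=0$; let $\mathcal{Z}$ denote the set of zeros of $f$. Assume $f$ satisfies the normal Hessian condition at $x_0$ with regularity $k \geq 1$ and dimension $d_0$, i.e. there is a sub-manifold $N$ of $\mathbb{R}^d$ of class $C^k$ and dimension $d_0$ with $x_0 \in N \subset \mathcal{Z}$ such that the rank of $\nabla^2 f(x_0)$ is $d - d_0$. Then there exists an open neighborhood $U$ of $x_0$ in $\mathbb{R}^d$ on which $f$ is defined such that $U \cap \mathcal{Z}$ is a sub-manifold of $\mathbb{R}^d$ of dimension $d_0$ and of class $C^{\max(k,p-1)}$, and there exist functions $f_i \in C^{p-2}(U)$, $1 \leq i \leq d-d_0$, such that \[ \forall x \in U,\quad f(x) = \sum_{i=1}^{d-d_0} f_i(x)^2. \]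
   Context: A subset $N \subset \mathbb{R}^d$ is a sub-manifold of $\mathbb{R}^d$ of class $C^k$ ($k \geq 1$) if for every $x \in N$ there is an integer $d_x$, an open neighborhood $U'$ of $0$ in $\mathbb{R}^{d_x}$, an open set $V \subset \mathbb{R}^d$ and a $C^k$ map $\phi: U' \to \mathbb{R}^d$ with $\phi(0)=x$, $\phi(U') = N \cap V$, $\phi: U' \to \phi(U')$ a homeomorphism, and $d\phi(0)$ injective; $d_x$ is the dimension of $N$ at $x$ (a sub-manifold ''of dimension $d_0$'' has $d_x=d_0$ at all its points) and $T_xN = d\phi(0)(\mathbb{R}^{d_x})$ is its tangent space. The rank condition is equivalent to the restriction of $d^2f(x_0)$ to $(T_{x_0}N)^\perp$ being positive definite. *)

(* Defs.v *)
From HB Require Import structures.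
From mathcomp Require Import all_boot all_order all_algebra.
From mathcomp Require Import all_classical all_reals all_analysis.
Set Implicit Arguments. Unset Strict Implicit. Unset Printing Implicit Defensive.
Import Order.TTheory GRing.Theory Num.Theory.
Import numFieldNormedType.Exports.
Local Open Scope classical_set_scope.
Local Open Scope ring_scope.

Fixpoint pder (R : realType) (m : nat) (W : normedModType R) (s : seq 'I_m)
  (f : 'rV[R]_m -> W) : 'rV[R]_m -> W :=
  match s with
  | [::] => f
  | i :: s' => fun x => derive (pder s' f) x (delta_mx 0 i : 'rV[R]_m)
  end.

Definition Ck_on (R : realType) (m : nat) (W : normedModType R) (k : nat)
  (U : set 'rV[R]_m) (f : 'rV[R]_m -> W) : Prop :=
  (forall (s : seq 'I_m) (i : 'I_m), (size s < k)%N ->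
      forall x, U x -> derivable (pder s f) x (delta_mx 0 i : 'rV[R]_m)) /\
  (forall (s : seq 'I_m), (size s <= k)%N ->
      forall x, U x -> {for x, continuous (pder s f)}).

Definition submanifold (R : realType) (d : nat) (k d0 : nat) (N : set 'rV[R]_d) : Prop :=
  forall x, N x ->
    exists (U' : set 'rV[R]_d0) (V : set 'rV[R]_d) (phi : 'rV[R]_d0 -> 'rV[R]_d),
      [/\ open U' /\ U' 0, open V, Ck_on k U' phi /\ phi 0 = x,
          phi @` U' = N `&` V &
          (* phi : U' -> phi(U') is a homeomorphism (phi is continuous by
             Ck_on): it has an inverse g on phi(U'), continuous on phi(U') *)
          ((exists g : 'rV[R]_d -> 'rV[R]_d0,
              (forall z, U' z -> g (phi z) = z) /\
              {within phi @` U', continuous g})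
          /\ injective ('d phi 0))].

Definition hessian (R : realType) (d : nat) (f : 'rV[R]_d -> R) (x : 'rV[R]_d)
  : 'M[R]_d := \matrix_(i, j) pder [:: i; j] f x.

(* Main.v *)
Require Import Defs.
From HB Require Import structures.
From mathcomp Require Import all_boot all_order all_algebra.
From mathcomp Require Import all_classical all_reals all_analysis.
From mathcomp Require Import perm ring lra zify.
Set Implicit Arguments. Unset Strict Implicit. Unset Printing Implicit Defensive.
Import Order.TTheory GRing.Theory Num.Theory.
Import numFieldNormedType.Exports.
Local Open Scope classical_set_scope.
Local Open Scope ring_scope.

(** If [d^2 f / dx_i^2 > 0] at [x0], the equation [df/dx_i = 0] defines, by the
    scalar implicit function theorem, a graph [x_i = g(w)], [w] being the other
    coordinates, with [g] of class [C^(p-1)].  Taylor's formula with integral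
    remainder around that graph gives [f(x) = e(w) + (x_i - g(w))^2 q(x)] with
    [q > 0] of class [C^(p-2)] and [e(w) = f(w, g(w))].  Since [df/dx_i] vanishes
    on the graph, the gradient of [e] is a restriction of that of [f], so [e] is
    again of class [C^p] and the step can be repeated; the Hessian of [e] is the
    Schur complement of that of [f], so its rank drops by one.  A non-negative
    function vanishing at [x0] with nonzero Hessian there has a nonzero diagonal
    entry, so after [d - d0] steps [f] is a sum of [d - d0] squares plus a
    function of [d0] of the coordinates, and the zeros of [f] lie on the graph of
    a [C^(p-1)] map [sg] over these coordinates.  As [N] lies on this graph and
    has the same dimension, its projection to the [d0] coordinates is a local
    diffeomorphism, hence covers a neighbourhood: the remaining function is zero
    there and the zero set coincides both with [N] and with the graph of [sg]. *)

Local Notation pd i f := (pder [:: i] f).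

(** * Mean values and differentiability *)

Section RowVectors.
Context {R : realType}.

Lemma rV_ballP m (x y : 'rV[R]_m) r : 0 < r ->
  (ball x r y <-> forall j, `|x 0 j - y 0 j| < r).
Proof.
move=> r0; split=> [[_ H] j|H]; first exact: H.
by split=> // i j; rewrite (ord1 i); exact: H.
Qed.

Lemma continuous_rVP (T : topologicalType) m (F : T -> 'rV[R]_m) x :
  {for x, continuous F} <-> forall j, {for x, continuous (fun z => F z 0 j)}.
Proof.
split=> [cF j|H].
  apply: (@continuous_comp _ _ R F (fun v : 'rV[R]_m => v 0 j) x cF).
  exact: coord_continuous.
apply/cvg_ballP => e e0.
have H1 : \forall z \near x, forall j, `|F x 0 j - F z 0 j| < e.
  apply: filter_forall => j.
  by have /cvgrPdist_lt/(_ _ e0) := H j.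
by near=> z; apply/rV_ballP => //; near: z.
Unshelve. all: by end_near. Qed.

Lemma continuous_sum (T : topologicalType) n (F : 'I_n -> T -> R) (x : T) :
  (forall i, {for x, continuous (F i)}) ->
  {for x, continuous (fun z => \sum_(i < n) F i z)}.
Proof.
move=> H; rewrite -fct_sumE; elim/big_ind : _ => [|f g cf cg|i _//].
  exact: cvg_cst.
exact: cvgD.
Qed.

Lemma row_as_sum m (v : 'rV[R]_m) : v = \sum_i v 0 i *: delta_mx 0 i.
Proof. exact: row_sum_delta. Qed.

Lemma normr_rV_coord m (v : 'rV[R]_m) j : `|v 0 j| <= `|v|.
Proof.
by rewrite [leRHS]/Num.Def.normr/= mx_normrE; exact: (le_bigmax _ _ (0, j)).
Qed.

Lemma normr_rV_le m (v : 'rV[R]_m) e : 0 <= e ->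
  (forall j, `|v 0 j| <= e) -> `|v| <= e.
Proof.
move=> e0 H; rewrite /Num.Def.normr/= mx_normrE bigmax_le// => -[i j] _ /=.
by rewrite (ord1 i).
Qed.

End RowVectors.

Section MeanValue.
Context {R : realType}.

Lemma is_derive_line (V W : normedModType R) (f : V -> W) (x v : V) (a : R) :
  derivable f (x + a *: v) v ->
  is_derive a 1 (fun t => f (x + t *: v)) ('D_v f (x + a *: v)).
Proof.
move=> df.
have E : (fun h : R => h^-1 *: (f (x + (h *: 1 + a) *: v) - f (x + a *: v))) =
         (fun h : R => h^-1 *: (f (h *: v + (x + a *: v)) - f (x + a *: v))).
  apply/funext => h; congr (_ *: (f _ - _)).
  by rewrite [h *: 1]mulr1 scalerDl addrCA.
by apply: DeriveDef; rewrite /derivable /derive /= E.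
Qed.

(** Stated for endpoints in either order, because later increments along an axis may have any
    sign. *)
Lemma MVT_minmax (f df : R -> R) (a b : R) :
  (forall x, Num.min a b <= x <= Num.max a b -> is_derive x 1 f (df x)) ->
  exists2 c, Num.min a b <= c <= Num.max a b & f b - f a = df c * (b - a).
Proof.
wlog ab : a b / a <= b => [hw|H].
  have /orP[/hw//|ba] := le_total a b.
  rewrite minC maxC => H; have [c c1 c2] := hw b a ba H.
  by exists c; rewrite // -opprB c2 -mulrN opprB.
move: H; rewrite (min_l ab) (max_r ab) => H.
have [||c c1 c2] := @MVT_segment R f df a b ab.
- by move=> x; rewrite in_itv/= => /andP[h1 h2]; apply: H; rewrite !ltW.
- apply: derivable_within_continuous => x; rewrite in_itv/= => h.
  by have [] := H x h.
by exists c; rewrite // -in_itv.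
Qed.

Lemma mvt_axis m (f : 'rV[R]_m -> R) x i t :
  (forall s, Num.min 0 t <= s <= Num.max 0 t ->
     derivable f (x + s *: delta_mx 0 i) (delta_mx 0 i)) ->
  exists2 s, Num.min 0 t <= s <= Num.max 0 t &
    f (x + t *: delta_mx 0 i) - f x = t * pd i f (x + s *: delta_mx 0 i).
Proof.
move=> H.
have [|s s1 s2] := @MVT_minmax (fun s => f (x + s *: delta_mx 0 i))
   (fun s => pd i f (x + s *: delta_mx 0 i)) 0 t.
  by move=> s hs; apply: is_derive_line; exact: H.
by exists s => //; move: s2; rewrite scale0r addr0 subr0 mulrC.
Qed.

(** Walk from [a] to [b] changing one coordinate at a time. Balls of the sup norm are boxes, so
    every leg of the walk stays in the ball, and each leg yields its own point [xi i]. *)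
Lemma mvt_box m (f : 'rV[R]_m -> R) x0 r a b :
  (forall y i, ball x0 r y -> derivable f y (delta_mx 0 i)) ->
  ball x0 r a -> ball x0 r b ->
  exists2 xi : 'I_m -> 'rV[R]_m, (forall i, ball x0 r (xi i)) &
    f b - f a = \sum_i (b 0 i - a 0 i) * pd i f (xi i).
Proof.
move=> H Ba Bb; have r0 : 0 < r by case: Ba.
pose c k : 'rV[R]_m := \row_j (if (j < k)%N then b 0 j else a 0 j).
have cS (i : 'I_m) : c i.+1 = c i + (b 0 i - a 0 i) *: delta_mx 0 i.
  apply/rowP => j; rewrite !mxE eqxx/= ltnS leq_eqVlt.
  have [->|ji] := eqVneq j i.
    by rewrite eqxx ltnn mulr1 addrC subrK.
  by rewrite (negbTE (ji : (j : nat) != i)) mulr0 addr0.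
have K (i : 'I_m) : exists xi, ball x0 r xi /\
    f (c i.+1) - f (c i) = (b 0 i - a 0 i) * pd i f xi.
  have Bs s : Num.min 0 (b 0 i - a 0 i) <= s <= Num.max 0 (b 0 i - a 0 i) ->
      ball x0 r (c i + s *: delta_mx 0 i).
    move=> hs; apply/rV_ballP => // j; rewrite !mxE eqxx/=.
    move/(rV_ballP _ _ r0)/(_ j) : Ba; move/(rV_ballP _ _ r0)/(_ j) : Bb.
    have [->|ji] := eqVneq j i.
      rewrite ltnn mulr1 !ltr_norml => /andP[h1 h2] /andP[h3 h4].
      by move: hs; case: (leP 0 (b 0 i - a 0 i)) => ? /andP[h5 h6]; apply/andP; split; lra.
    by rewrite mulr0 addr0; case: ifP.
  have [|s hs E] := @mvt_axis m f (c i) i (b 0 i - a 0 i).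
    by move=> s hs; apply: H; exact: Bs.
  by exists (c i + s *: delta_mx 0 i); split; [exact: Bs|rewrite cS].
have [xi Hxi] := choice K.
exists xi => [i|]; first by have [] := Hxi i.
under [RHS]eq_bigr => i _ do rewrite -(proj2 (Hxi i)).
rewrite -(big_mkord xpredT (fun i => f (c i.+1) - f (c i))) telescope_sumr//.
by congr (f _ - f _); apply/rowP => j; rewrite !mxE ?ltn_ord.
Qed.

End MeanValue.

Section Differentiability.
Context {R : realType}.

(** The candidate differential with partial derivatives [c], made a linear map so that uniqueness of
    the differential applies to it. *)
Definition dform m (c : 'I_m -> R) (v : 'rV[R]_m) : R := \sum_i v 0 i * c i.

Lemma dform_is_linear m (c : 'I_m -> R) : linear (dform c).
Proof.
move=> a u v; rewrite /dform scaler_sumr -big_split/=.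
by apply: eq_bigr => i _; rewrite !mxE mulrDl -mulrA.
Qed.
HB.instance Definition _ m (c : 'I_m -> R) :=
  GRing.isLinear.Build R 'rV[R]_m R _ (dform c) (dform_is_linear c).

Lemma dform_continuous m (c : 'I_m -> R) : continuous (dform c).
Proof.
move=> v; apply: continuous_sum => i.
by apply: continuousM; [exact: coord_continuous|exact: cst_continuous].
Qed.

(** By [mvt_box] the error of the linear approximation is a sum of coordinates times increments of
    partial derivatives, which are small by continuity. *)
Lemma C1_differentiable m (f : 'rV[R]_m -> R) x :
  (\forall y \near x, forall i, derivable f y (delta_mx 0 i)) ->
  (forall i, {for x, continuous (pd i f)}) ->
  differentiable f x.
Proof.
move=> Hd Hc; pose L : {linear 'rV[R]_m -> R} := dform (fun i => pd i f x).
have Lc : continuous L by exact: dform_continuous.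
have Ho : f \o shift x = cst (f x) + L +o_ 0 id.
  apply/eqaddoP => e e0.
  (* The error has [m] terms; dividing by [m.+1] also covers [m = 0]. *)
  pose e' := e / m.+1%:R.
  have e'0 : 0 < e' by rewrite divr_gt0.
  have Hc' : \forall y \near x, forall i, `|pd i f x - pd i f y| < e'.
    apply: (filter_forall (nbhs_filter x)) => i.
    by have /cvgrPdist_lt/(_ _ e'0) := Hc i.
  have /nbhs_ballP[r /= r0 Hr] := @filterI _ _ (nbhs_filter x) _ _ Hd Hc'.
  apply/nbhs_ballP; exists r => // v /= Bv.
  have Bxv : ball x r (v + x).
    by move: Bv; rewrite -!ball_normE /ball_/= sub0r opprD addrCA subrr addr0.
  have [|||xi xi1 E] := @mvt_box R m f x r x (v + x).
  - by move=> y i /Hr[].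
  - exact: ballxx.
  - by [].
  rewrite -[X in `|X|]/(f (v + x) - (f x + L v)) opprD addrA E /L/= /dform -sumrB.
  apply: (le_trans (ler_norm_sum _ _ _)).
  apply: (@le_trans _ _ (\sum_(i < m) e' * `|v|)).
    apply: ler_sum => i _; rewrite !mxE addrK -mulrBr normrM mulrC.
    rewrite ler_pM// ?normr_rV_coord// distrC.
    by have [_ /(_ i)/ltW] := Hr _ (xi1 i).
  rewrite sumr_const card_ord -mulr_natl mulrA ler_wpM2r//.
  by rewrite /e' mulrC -mulrA ger_pMr// ler_pdivrMl// mulr1 ler_nat.
apply/diff_locallyP; rewrite (diff_unique Lc Ho); split=> //.
Qed.

Lemma diff_partialE m (f : 'rV[R]_m -> R) x v : differentiable f x ->
  'd f x v = \sum_i v 0 i * pd i f x.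
Proof.
move=> df; rewrite {1}(row_as_sum v) linear_sum; apply: eq_bigr => i _.
by rewrite linearZ/= deriveE.
Qed.

Lemma differentiable_rV (V : normedModType R) n (g : V -> 'rV[R]_n) x :
  (forall j, differentiable (fun z => g z 0 j) x) -> differentiable g x.
Proof.
move=> H.
have -> : g = \sum_(j < n) (fun z => g z 0 j *: (delta_mx 0 j : 'rV[R]_n)).
  by apply/funext => z; rewrite fct_sumE -row_as_sum.
by apply: differentiable_sum => j; apply: differentiableZl.
Qed.

Lemma differentiable_rV_coord (V : normedModType R) n (g : V -> 'rV[R]_n) x j :
  differentiable g x -> differentiable (fun z => g z 0 j) x.
Proof.
move=> dg; apply: (@differentiable_comp _ _ _ _ g (fun v : 'rV[R]_n => v 0 j)) => //.
exact: differentiable_coord.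
Qed.

Lemma diff_rV_coord (V : normedModType R) n (g : V -> 'rV[R]_n) x j v :
  differentiable g x -> 'd g x v 0 j = 'd (fun z => g z 0 j) x v.
Proof.
move=> dg; rewrite -!deriveE//; last exact: differentiable_rV_coord.
by rewrite derive_mx ?mxE//; exact: diff_derivable.
Qed.

Lemma derive_comp_rV m n (f : 'rV[R]_n -> R) (g : 'rV[R]_m -> 'rV[R]_n) x i :
  differentiable f (g x) -> (forall j, differentiable (fun z => g z 0 j) x) ->
  pd i (f \o g) x = \sum_j pd j f (g x) * pd i (fun z => g z 0 j) x.
Proof.
move=> df dgj; have dg := differentiable_rV dgj.
rewrite /= deriveE; last exact: differentiable_comp.
rewrite diff_comp//= diff_partialE//; apply: eq_bigr => j _.
by rewrite mulrC diff_rV_coord// -deriveE.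
Qed.

End Differentiability.

(** * Calculus of functions of class [C^k] *)

Section CkCalculus.
Context {R : realType}.

(** The head of the sequence is the outermost derivative; this isolates the innermost one, as an
    induction on the order requires. *)
Lemma pder_rcons m (W : normedModType R) s (i : 'I_m) (f : 'rV[R]_m -> W) :
  pder (rcons s i) f = pder s (pd i f).
Proof. by elim: s => //= j s ->. Qed.

Lemma Ck_on0 m (W : normedModType R) U (f : 'rV[R]_m -> W) :
  Ck_on 0 U f <-> forall x, U x -> {for x, continuous f}.
Proof.
split=> [[_ H] x Ux|H]; first exact: (H [::]).
by split=> // s; rewrite leqn0 size_eq0 => /eqP ->.
Qed.

(** The recursive form of the class, on which the closure properties below are proved by induction
    on [k]. *)
Lemma Ck_onS m (W : normedModType R) k U (f : 'rV[R]_m -> W) :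
  Ck_on k.+1 U f <->
  [/\ forall x, U x -> {for x, continuous f},
      forall x i, U x -> derivable f x (delta_mx 0 i) &
      forall i, Ck_on k U (pd i f)].
Proof.
split=> [[H1 H2]|[H1 H2 H3]].
  split=> [x|x i|i]; first exact: (H2 [::]).
    exact: (H1 [::]).
  split=> s => [j|] hs x Ux; rewrite -pder_rcons.
    by apply: H1; rewrite // size_rcons.
  by apply: H2; rewrite // size_rcons.
split=> [s j|s]; case/lastP: s => [|s i].
- by move=> _ x Ux; exact: H2.
- by rewrite size_rcons pder_rcons => hs x Ux; have [H _] := H3 i; exact: H.
- by move=> _; exact: H1.
- by rewrite size_rcons pder_rcons => hs x Ux; have [_ H] := H3 i; exact: H.
Qed.

Lemma Ck_onW m (W : normedModType R) k l U (f : 'rV[R]_m -> W) :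
  (l <= k)%N -> Ck_on k U f -> Ck_on l U f.
Proof.
move=> lk [H1 H2]; split=> [s i hs|s hs]; first exact/H1/(leq_trans hs).
exact/H2/(leq_trans hs).
Qed.

Lemma Ck_on_sub m (W : normedModType R) k U V (f : 'rV[R]_m -> W) :
  V `<=` U -> Ck_on k U f -> Ck_on k V f.
Proof.
by move=> VU [H1 H2]; split=> [s i hs x /VU|s hs x /VU]; [exact: H1|exact: H2].
Qed.

Lemma Ck_on_continuous m (W : normedModType R) k U (f : 'rV[R]_m -> W) x :
  Ck_on k U f -> U x -> {for x, continuous f}.
Proof. by move=> [_ H]; exact: (H [::]). Qed.

Lemma Ck_on_pd m (W : normedModType R) k U (f : 'rV[R]_m -> W) i :
  Ck_on k.+1 U f -> Ck_on k U (pd i f).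
Proof. by move=> /Ck_onS[]. Qed.

Lemma Ck_on_derivable m (W : normedModType R) k U (f : 'rV[R]_m -> W) x i :
  Ck_on k.+1 U f -> U x -> derivable f x (delta_mx 0 i).
Proof. by move=> /Ck_onS[_ H _]; exact: H. Qed.

Lemma open_near (T : topologicalType) (U : set T) x (P : T -> Prop) :
  open U -> U x -> (forall y, U y -> P y) -> \forall y \near x, P y.
Proof. by move=> oU Ux H; apply: filterS H _; exact: open_nbhs_nbhs. Qed.

Lemma continuous_near_eq (S T : topologicalType) (f g : S -> T) x :
  {near x, f =1 g} -> {for x, continuous f} -> {for x, continuous g}.
Proof.
move=> fg cf; suff : g y @[y --> x] --> g x by [].
by rewrite -(nbhs_singleton fg); apply: cvg_trans cf; exact: near_eq_cvg.
Qed.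

(** On an open set, equality at each point is equality near each point, hence passes to
    derivatives. *)
Lemma Ck_on_eq m (W : normedModType R) k U (f g : 'rV[R]_m -> W) :
  open U -> (forall x, U x -> f x = g x) -> Ck_on k U f -> Ck_on k U g.
Proof.
move=> oU; elim: k f g => [|k IH] f g fg.
  move=> /Ck_on0 H; apply/Ck_on0 => x Ux.
  by apply: continuous_near_eq (H _ Ux); exact: (open_near oU Ux).
move=> /Ck_onS[H1 H2 H3]; apply/Ck_onS; split=> [x Ux|x i Ux|i].
- by apply: continuous_near_eq (H1 _ Ux); exact: (open_near oU Ux).
- by apply: near_eq_derivable (H2 _ i Ux); exact: (open_near oU Ux).
- apply: IH (H3 i) => x Ux; apply: near_eq_derive.
  exact: (open_near oU Ux).
Qed.

Lemma Ck_on_cst m (W : normedModType R) k U (c : W) :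
  Ck_on k U (fun _ : 'rV[R]_m => c).
Proof.
elim: k c => [|k IH] c; first by apply/Ck_on0 => x _; exact: cst_continuous.
apply/Ck_onS; split=> [x _|x i _|i]; first exact: cst_continuous.
  exact: derivable_cst.
rewrite (_ : pd i _ = (fun=> 0)) //.
by apply/funext => x /=; rewrite derive_cst.
Qed.

Lemma is_derive_coord m (i j : 'I_m) (x : 'rV[R]_m) :
  is_derive x (delta_mx 0 i) (fun z : 'rV[R]_m => z 0 j) ((i == j)%:R : R).
Proof.
have dc := @differentiable_coord R _ _ x 0 j.
apply: DeriveDef; first exact: diff_derivable.
have := @derive_mx R _ 1 m id x (delta_mx 0 i) (@derivable_id R _ x _).
rewrite derive_id => /rowP/(_ j); rewrite !mxE eqxx eq_sym => <-.
by rewrite eq_sym.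
Qed.

Lemma Ck_on_coord m k U (j : 'I_m) :
  Ck_on k U (fun z : 'rV[R]_m => z 0 j).
Proof.
case: k => [|k]; first by apply/Ck_on0 => x _; exact: coord_continuous.
apply/Ck_onS; split=> [x _|x i _|i]; first exact: coord_continuous.
  by have [] := is_derive_coord i j x.
rewrite (_ : pd i _ = (fun=> (i == j)%:R : R)); first exact: Ck_on_cst.
by apply/funext => x; have [] := is_derive_coord i j x.
Qed.

Lemma Ck_onD m k U (f g : 'rV[R]_m -> R) : open U ->
  Ck_on k U f -> Ck_on k U g -> Ck_on k U (fun x => f x + g x).
Proof.
move=> oU; elim: k f g => [|k IH] f g.
  move=> /Ck_on0 Hf /Ck_on0 Hg; apply/Ck_on0 => x Ux.
  by apply: continuousD; [exact: Hf|exact: Hg].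
move=> /Ck_onS[Hf1 Hf2 Hf3] /Ck_onS[Hg1 Hg2 Hg3]; apply/Ck_onS; split.
- by move=> x Ux; apply: continuousD; [exact: Hf1|exact: Hg1].
- by move=> x i Ux; apply: derivableD; [exact: Hf2|exact: Hg2].
- move=> i; apply: Ck_on_eq oU _ (IH _ _ (Hf3 i) (Hg3 i)) => x Ux /=.
  by rewrite deriveD//; [exact: Hf2|exact: Hg2].
Qed.

Lemma Ck_on_sum m n k U (f : 'I_n -> 'rV[R]_m -> R) : open U ->
  (forall i, Ck_on k U (f i)) -> Ck_on k U (fun x => \sum_i f i x).
Proof.
move=> oU H; rewrite -fct_sumE; elim/big_ind : _ => [|u v|i _//].
  exact: Ck_on_cst.
exact: Ck_onD.
Qed.

Lemma Ck_onM m k U (f g : 'rV[R]_m -> R) : open U ->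
  Ck_on k U f -> Ck_on k U g -> Ck_on k U (fun x => f x * g x).
Proof.
move=> oU; elim: k f g => [|k IH] f g.
  move=> /Ck_on0 Hf /Ck_on0 Hg; apply/Ck_on0 => x Ux.
  by apply: continuousM; [exact: Hf|exact: Hg].
move=> Hf Hg.
have [Hf1 Hf2 Hf3] := (Ck_onS _ _ _).1 Hf; have [Hg1 Hg2 Hg3] := (Ck_onS _ _ _).1 Hg.
apply/Ck_onS; split.
- by move=> x Ux; apply: continuousM; [exact: Hf1|exact: Hg1].
- by move=> x i Ux; apply: derivableM; [exact: Hf2|exact: Hg2].
- move=> i; have W := Ck_onW (leqnSn k).
  have H := Ck_onD oU (IH _ _ (W _ _ _ _ Hf) (Hg3 i)) (IH _ _ (W _ _ _ _ Hg) (Hf3 i)).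
  apply: Ck_on_eq oU _ H => x Ux /=.
  by rewrite deriveM//; [exact: Hf2|exact: Hg2].
Qed.

Lemma Ck_onN m k U (f : 'rV[R]_m -> R) : open U ->
  Ck_on k U f -> Ck_on k U (fun x => - f x).
Proof.
move=> oU Hf; have H := Ck_onM oU (@Ck_on_cst m R k U (-1)) Hf.
by apply: Ck_on_eq oU _ H => x _; rewrite mulN1r.
Qed.

Lemma Ck_onB m k U (f g : 'rV[R]_m -> R) : open U ->
  Ck_on k U f -> Ck_on k U g -> Ck_on k U (fun x => f x - g x).
Proof. by move=> oU Hf Hg; apply: Ck_onD => //; exact: Ck_onN. Qed.

Lemma Ck_on_differentiable m k U (f : 'rV[R]_m -> R) x : open U -> U x ->
  Ck_on k.+1 U f -> differentiable f x.
Proof.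
move=> oU Ux /Ck_onS[H1 H2 H3]; apply: C1_differentiable.
  by apply: (open_near oU Ux) => y Uy i; exact: H2.
by move=> i; exact: Ck_on_continuous (H3 i) Ux.
Qed.

(** The derivative of the inverse is a product of the derivative of [f] with two copies of the
    inverse itself, to which the induction hypothesis applies. *)
Lemma Ck_onV m k U (f : 'rV[R]_m -> R) : open U ->
  (forall x, U x -> f x != 0) -> Ck_on k U f -> Ck_on k U (fun x => (f x)^-1).
Proof.
move=> oU f0; elim: k => [|k IH] Hf.
  move/Ck_on0 : Hf => Hf; apply/Ck_on0 => x Ux.
  by apply: continuousV; [exact: f0|exact: Hf].
have [Hf1 Hf2 Hf3] := (Ck_onS _ _ _).1 Hf; apply/Ck_onS; split.
- by move=> x Ux; apply: continuousV; [exact: f0|exact: Hf1].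
- by move=> x i Ux; apply: derivableV; [exact: f0|exact: Hf2].
- move=> i; have Hi := IH (Ck_onW (leqnSn k) Hf).
  have H := Ck_onN oU (Ck_onM oU (Ck_onM oU Hi Hi) (Hf3 i)).
  apply: Ck_on_eq oU _ H => x Ux /=.
  rewrite deriveV//; [|exact: f0|exact: Hf2].
  by rewrite scaleNr expr2 invfM.
Qed.

(** Same bootstrap as for the inverse: the derivative is that of [f] divided by twice the root. *)
Lemma Ck_on_sqrt m k U (f : 'rV[R]_m -> R) : open U ->
  (forall x, U x -> 0 < f x) -> Ck_on k U f ->
  Ck_on k U (fun x => Num.sqrt (f x)).
Proof.
move=> oU f0; elim: k => [|k IH] Hf.
  move/Ck_on0 : Hf => Hf; apply/Ck_on0 => x Ux.
  by apply: (continuous_comp (Hf _ Ux)); exact: sqrt_continuous.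
have [Hf1 Hf2 Hf3] := (Ck_onS _ _ _).1 Hf; apply/Ck_onS.
have ds x : U x -> differentiable (@Num.sqrt R) (f x).
  by move=> Ux; apply/derivable1_diffP; have [] := is_derive1_sqrt (f0 _ Ux).
have df x : U x -> differentiable f x.
  by move=> Ux; exact: Ck_on_differentiable Ux Hf.
split.
- by move=> x Ux; apply: (continuous_comp (Hf1 _ Ux)); exact: sqrt_continuous.
- move=> x i Ux; apply: diff_derivable.
  by apply: (@differentiable_comp _ _ _ _ f) => //; [exact: df|exact: ds].
- move=> i; have Hi := IH (Ck_onW (leqnSn k) Hf).
  have H2 : Ck_on k U (fun x => (2 * Num.sqrt (f x))^-1).
    apply: Ck_onV => // [x Ux|]; first by rewrite mulf_neq0// gt_eqF// sqrtr_gt0 f0.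
    exact: Ck_onM oU (@Ck_on_cst m R k U 2) Hi.
  apply: Ck_on_eq oU _ (Ck_onM oU (Hf3 i) H2) => x Ux /=.
  rewrite [RHS]deriveE; last first.
    by apply: (@differentiable_comp _ _ _ _ f) => //; [exact: df|exact: ds].
  rewrite (diff_comp (df _ Ux) (ds _ Ux))/=.
  rewrite -(deriveE _ (df _ Ux)).
  rewrite deriv1E; last by apply/derivable1_diffP; exact: ds.
  by rewrite derive1E derive_sqrt ?f0.
Qed.

(** The chain rule involves the composites [pd j f \o g], so the induction on [k] runs over all [f]
    at once. *)
Lemma Ck_on_comp m n k U V (f : 'rV[R]_n -> R) (g : 'rV[R]_m -> 'rV[R]_n) :
  open U -> open V -> (forall x, U x -> V (g x)) ->
  Ck_on k V f -> (forall j, Ck_on k U (fun x => g x 0 j)) ->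
  Ck_on k U (f \o g).
Proof.
move=> oU oV UV; elim: k f => [|k IH] f Hf Hg.
  apply/Ck_on0 => x Ux; apply: continuous_comp.
    by apply/continuous_rVP => j; exact: Ck_on_continuous (Hg j) Ux.
  exact: Ck_on_continuous Hf (UV _ Ux).
have cg x : U x -> {for x, continuous g}.
  by move=> Ux; apply/continuous_rVP => j; exact: Ck_on_continuous (Hg j) Ux.
have dg x : U x -> forall j, differentiable (fun z => g z 0 j) x.
  by move=> Ux j; exact: Ck_on_differentiable oU Ux (Hg j).
have df x : U x -> differentiable f (g x).
  by move=> Ux; exact: Ck_on_differentiable oV (UV _ Ux) Hf.
apply/Ck_onS; split.
- move=> x Ux; apply: continuous_comp; first exact: cg.
  exact: Ck_on_continuous Hf (UV _ Ux).
- move=> x i Ux; apply/diff_derivable/differentiable_comp.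
    exact/differentiable_rV/dg.
  exact: df.
- move=> i.
  have H : Ck_on k U (fun x => \sum_j (pd j f \o g) x * pd i (fun z => g z 0 j) x).
    apply: Ck_on_sum => // j; apply: Ck_onM => //; last exact: Ck_on_pd.
    apply: IH; first exact: Ck_on_pd.
    by move=> j'; apply: Ck_onW (Hg j').
  apply: Ck_on_eq oU _ H => x Ux.
  by rewrite derive_comp_rV//; [exact: df|exact: dg].
Qed.

(** Passes between the vector-valued charts of [submanifold] and the scalar coordinates handled by
    the calculus above. *)
Lemma Ck_on_rVP m n k U (g : 'rV[R]_m -> 'rV[R]_n) : open U ->
  Ck_on k U g <-> forall j, Ck_on k U (fun x => g x 0 j).
Proof.
move=> oU; elim: k g => [|k IH] g.
  split=> [/Ck_on0 H j|H]; apply/Ck_on0 => x Ux.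
    by have /continuous_rVP := H _ Ux.
  by apply/continuous_rVP => j; exact: Ck_on_continuous (H j) Ux.
have E i x : derivable g x (delta_mx 0 i) -> forall j,
    pd i g x 0 j = pd i (fun x => g x 0 j) x.
  by move=> dg j /=; rewrite derive_mx// mxE.
split=> [/Ck_onS[H1 H2 H3] j|H].
  apply/Ck_onS; split=> [x Ux|x i Ux|i].
  - by have /continuous_rVP := H1 _ Ux.
  - by have /derivable_mxP := H2 _ i Ux.
  - have /IH/(_ j) := H3 i; apply: Ck_on_eq oU _ => x Ux.
    by rewrite E//; exact: H2.
have dg i x : U x -> derivable g x (delta_mx 0 i).
  move=> Ux; apply/derivable_mxP => a j; rewrite (ord1 a).
  exact: Ck_on_derivable (H j) Ux.
apply/Ck_onS; split=> [x Ux|x i Ux|i].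
- by apply/continuous_rVP => j; exact: Ck_on_continuous (H j) Ux.
- exact: dg.
- apply/IH => j; have := Ck_on_pd i (H j).
  by apply: Ck_on_eq oU _ => x Ux; rewrite E//; exact: dg.
Qed.

End CkCalculus.

(** * The scalar implicit function theorem *)

Section ContinuityAt.
Context {R : realType}.

Lemma continuous_distP (T : topologicalType) (f : T -> R) x :
  {for x, continuous f} <->
  forall e, 0 < e -> \forall y \near x, `|f x - f y| < e.
Proof. by split=> [/cvgrPdist_lt|H]; last exact/cvgrPdist_lt. Qed.

Lemma continuous_ballP (T : topologicalType) m (f : T -> 'rV[R]_m) x :
  {for x, continuous f} <->
  forall e, 0 < e -> \forall y \near x, ball (f x) e (f y).
Proof. by split=> [/cvg_ballP|H]; last exact/cvg_ballP. Qed.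

Lemma continuous_gt (T : topologicalType) (f : T -> R) x c :
  {for x, continuous f} -> c < f x -> \forall y \near x, c < f y.
Proof. by move=> cf cx; exact: (cvgr_gt (f x)). Qed.

Lemma continuous_lt (T : topologicalType) (f : T -> R) x c :
  {for x, continuous f} -> f x < c -> \forall y \near x, f y < c.
Proof. by move=> cf cx; exact: (cvgr_lt (f x)). Qed.

Lemma filterI_near (T : topologicalType) (x : T) (P Q : T -> Prop) :
  (\forall y \near x, P y) -> (\forall y \near x, Q y) ->
  \forall y \near x, P y /\ Q y.
Proof. by move=> HP HQ; exact: filterI. Qed.

Lemma near_ballP m (x : 'rV[R]_m) (P : 'rV[R]_m -> Prop) :
  (\forall y \near x, P y) <-> exists2 r, 0 < r & forall y, ball x r y -> P y.
Proof. by split=> [/nbhs_ballP[r r0 H]|[r r0 H]]; [|apply/nbhs_ballP]; exists r. Qed.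

End ContinuityAt.

(** * Selecting, deleting and inserting coordinates *)

Section Coordinates.
Context {R : realType}.

Definition sel d n (h : 'I_n -> 'I_d) (x : 'rV[R]_d) : 'rV[R]_n :=
  \row_j x 0 (h j).

(* The ascription keeps the dimension syntactically [d] instead of [d.+1.-1]. *)
Definition del d (i : 'I_d.+1) : 'rV[R]_d.+1 -> 'rV[R]_d :=
  @sel d.+1 d (lift i).

Lemma delE d (i : 'I_d.+1) x j : del i x 0 j = x 0 (lift i j).
Proof. by rewrite mxE. Qed.

(** The point with [i]-th coordinate [t] and remaining coordinates [w]; with [del i] it identifies
    the space with a product of a hyperplane and a line. *)
Definition ins d (i : 'I_d.+1) (w : 'rV[R]_d) (t : R) : 'rV[R]_d.+1 :=
  \row_j (if unlift i j is Some j' then w 0 j' else t).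

Lemma ins_at d (i : 'I_d.+1) w t : ins i w t 0 i = t.
Proof. by rewrite mxE unlift_none. Qed.

Lemma ins_lift d (i : 'I_d.+1) w t j : ins i w t 0 (lift i j) = w 0 j.
Proof. by rewrite mxE liftK. Qed.

Lemma del_ins d (i : 'I_d.+1) w t : del i (ins i w t) = w.
Proof. by apply/rowP => j; rewrite delE ins_lift. Qed.

Lemma ins_del d (i : 'I_d.+1) x : ins i (del i x) (x 0 i) = x.
Proof. by apply/rowP => j; rewrite mxE; case: unliftP => [j' ->|->]; rewrite ?delE. Qed.

Lemma ins_addr d (i : 'I_d.+1) w t s :
  ins i w (t + s) = ins i w t + s *: delta_mx 0 i.
Proof.
apply/rowP => j; rewrite !mxE eqxx/=; case: unliftP => [j' ->|->].
  by rewrite eq_sym (negbTE (neq_lift _ _)) mulr0 addr0.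
by rewrite eqxx mulr1.
Qed.

Lemma ball_ins d (i : 'I_d.+1) x0 r w t : 0 < r ->
  ball x0 r (ins i w t) <-> ball (del i x0) r w /\ `|x0 0 i - t| < r.
Proof.
move=> r0; split=> [/(rV_ballP _ _ r0) H|[/(rV_ballP _ _ r0) H1 H2]].
  split; last by have := H i; rewrite ins_at.
  by apply/rV_ballP => // j; have := H (lift i j); rewrite ins_lift delE.
apply/rV_ballP => // j; case: (unliftP i j) => [j' ->|->]; last by rewrite ins_at.
by rewrite ins_lift; have := H1 j'; rewrite delE.
Qed.

Lemma Ck_on_sel d n (h : 'I_n -> 'I_d) k U j :
  Ck_on k U (fun x : 'rV[R]_d => sel h x 0 j).
Proof.
rewrite (_ : (fun x => _) = (fun x : 'rV[R]_d => x 0 (h j))).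
  exact: Ck_on_coord.
by apply/funext => x; rewrite mxE.
Qed.

Lemma sel_continuous d n (h : 'I_n -> 'I_d) : continuous (@sel d n h).
Proof.
move=> x; apply/continuous_rVP => j.
exact: Ck_on_continuous (@Ck_on_sel d n h 0 setT j) _.
Qed.

Lemma Ck_on_ins d m (i : 'I_d.+1) k U (w : 'rV[R]_m -> 'rV[R]_d) g j :
  (forall j', Ck_on k U (fun z => w z 0 j')) -> Ck_on k U g ->
  Ck_on k U (fun z => ins i (w z) (g z) 0 j).
Proof.
move=> Hw Hg; case: (unliftP i j) => [j' ->|->].
  rewrite (_ : (fun z => _) = (fun z => w z 0 j'))//.
  by apply/funext => z; rewrite ins_lift.
rewrite (_ : (fun z => _) = g)//.
by apply/funext => z; rewrite ins_at.
Qed.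

Lemma ins_continuous_at (T : topologicalType) d (i : 'I_d.+1)
    (w : T -> 'rV[R]_d) (g : T -> R) z :
  {for z, continuous w} -> {for z, continuous g} ->
  {for z, continuous (fun z => ins i (w z) (g z))}.
Proof.
move=> cw cg; apply/continuous_rVP => j; case: (unliftP i j) => [j' ->|->].
  rewrite (_ : (fun z => _) = (fun z => w z 0 j')).
    exact: (continuous_rVP _ _).1.
  by apply/funext => y; rewrite ins_lift.
rewrite (_ : (fun z => _) = g)//.
by apply/funext => y; rewrite ins_at.
Qed.

End Coordinates.

Section ImplicitFunction.
Context {R : realType}.

Lemma is_derive_cvg (V W : normedModType R) (f : V -> W) x v D :
  h^-1 *: (f (h *: v + x) - f x) @[h --> 0^'] --> D -> is_derive x v f D.
Proof.
move=> H; apply: DeriveDef; first by apply/cvg_ex; exists D.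
exact: cvg_lim.
Qed.

Section OneVariable.
Variables (d : nat) (i : 'I_d.+1) (F : 'rV[R]_d.+1 -> R) (x0 : 'rV[R]_d.+1) (r : R).
Hypothesis r0 : 0 < r.
Hypothesis dF : forall x, ball x0 r x -> derivable F x (delta_mx 0 i).
Hypothesis F'0 : forall x, ball x0 r x -> 0 < pd i F x.
Let a := x0 0 i.
Let w0 := del i x0.

(** The mean value theorem along axis [i], where the derivative is positive. *)
Lemma ins_lt w t t' : ball w0 r w -> `|a - t| < r -> `|a - t'| < r -> t < t' ->
  F (ins i w t) < F (ins i w t').
Proof.
move=> Bw ht ht' tt'.
have Bs s : 0 <= s <= t' - t -> ball x0 r (ins i w t + s *: delta_mx 0 i).
  move=> /andP[s0 s1]; rewrite -ins_addr; apply/ball_ins => //; split=> //.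
  by move: ht ht'; rewrite -/a !ltr_norml; lra.
have tt0 : 0 <= t' - t by lra.
have [|s] := @mvt_axis R d.+1 F (ins i w t) i (t' - t).
  by rewrite (min_l tt0) (max_r tt0) => s hs; apply/dF/Bs.
rewrite (min_l tt0) (max_r tt0) -ins_addr addrCA subrr addr0 => hs E.
by rewrite -subr_gt0 E mulr_gt0 ?subr_gt0// F'0//; exact: Bs.
Qed.

Lemma ins_root w t t' : ball w0 r w -> `|a - t| < r -> `|a - t'| < r -> t <= t' ->
  F (ins i w t) <= 0 -> 0 <= F (ins i w t') ->
  exists2 s, t <= s <= t' & F (ins i w s) = 0.
Proof.
move=> Bw ht ht' tt' Ft Ft'.
have cF : {within `[t, t'], continuous (fun s => F (ins i w s))}.
  apply: derivable_within_continuous => s; rewrite in_itv/= => hs.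
  have E : (fun s => F (ins i w s)) = (fun s => F (ins i w 0 + s *: delta_mx 0 i)).
    by apply/funext => u; rewrite -ins_addr add0r.
  rewrite E; have [] // := @is_derive_line R _ _ F (ins i w 0) (delta_mx 0 i) s _.
  apply: dF; rewrite -ins_addr add0r; apply/ball_ins => //; split=> //.
  by move: ht ht'; rewrite -/a !ltr_norml; lra.
have [|s s1 s2] := @IVT R _ t t' 0 tt' cF.
  by rewrite (min_l (le_trans Ft Ft')) (max_r (le_trans Ft Ft')) Ft Ft'.
by exists s.
Qed.

End OneVariable.

(** On each line parallel to axis [i] the root exists by the intermediate value theorem and is
    unique by monotonicity. The radius [r] bounds the box where [F] is controlled, the smaller [rho]
    the domain of [g]. *)
Lemma implicit_scalar d (i : 'I_d.+1) k W (F : 'rV[R]_d.+1 -> R) x0 :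
  open W -> W x0 -> Ck_on k.+1 W F -> F x0 = 0 -> 0 < pd i F x0 ->
  exists r, exists2 rho, 0 < rho <= r & exists g : 'rV[R]_d -> R,
  let w0 := del i x0 in let B := ball w0 rho in
  [/\ ball x0 r `<=` W /\ (forall x, ball x0 r x -> 0 < pd i F x),
      forall w, B w -> ball x0 r (ins i w (g w)),
      forall w, B w -> F (ins i w (g w)) = 0,
      g w0 = x0 0 i &
      Ck_on k.+1 B g /\
      forall w j, B w -> pd j g w =
        - (pd (lift i j) F (ins i w (g w)) / pd i F (ins i w (g w)))].
Proof.
move=> oW Wx0 HF Fx0 F'x0.
have [r0 r00 Hr] : exists2 r, 0 < r & forall x, ball x0 r x -> W x /\ 0 < pd i F x.
  have H1 : \forall x \near x0, 0 < pd i F x.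
    by apply: continuous_gt => //; exact: Ck_on_continuous (Ck_on_pd i HF) Wx0.
  have H2 : \forall x \near x0, W x by exact: open_nbhs_nbhs.
  exact/near_ballP/filterI_near.
have dF x : ball x0 r0 x -> derivable F x (delta_mx 0 i).
  by move=> /Hr[Wx _]; exact: Ck_on_derivable HF Wx.
have F'0 x : ball x0 r0 x -> 0 < pd i F x by move=> /Hr[].
have mono := ins_lt r00 dF F'0.
have root := ins_root r00 dF.
have cF x : ball x0 r0 x -> {for x, continuous F}.
  by move=> /Hr[Wx _]; exact: Ck_on_continuous HF Wx.
pose w0 := del i x0; pose a := x0 0 i.
have x0E : ins i w0 a = x0 by exact: ins_del.
have Bw0 : ball w0 r0 w0 by exact: ballxx.
have h0 : `|a - a| < r0 by rewrite subrr normr0.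
have hp : `|a - (a + r0 / 2)| < r0 by rewrite ltr_norml; lra.
have hm : `|a - (a - r0 / 2)| < r0 by rewrite ltr_norml; lra.
have cins w t : ball w0 r0 w -> `|a - t| < r0 ->
    {for w, continuous (fun w => F (ins i w t))}.
  move=> Bw ht; apply: continuous_comp; last by apply: cF; apply/ball_ins.
  by apply: ins_continuous_at; [exact: cvg_id|exact: cst_continuous].
(* The strict signs of [F] at heights [a - r0 / 2] and [a + r0 / 2] over [w0] persist for nearby
   [w], so that a root lies in between. *)
have [rho /andP[rho0 rhor] Hrho] : exists2 rho, 0 < rho <= r0 &
    forall w, ball w0 rho w -> F (ins i w (a - r0 / 2)) < 0 < F (ins i w (a + r0 / 2)).
  have H1 : \forall w \near w0, 0 < F (ins i w (a + r0 / 2)).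
    apply: continuous_gt; first exact: cins.
    by rewrite -Fx0 -x0E; apply: mono => //; lra.
  have H2 : \forall w \near w0, F (ins i w (a - r0 / 2)) < 0.
    apply: continuous_lt; first exact: cins.
    by rewrite -Fx0 -x0E; apply: mono => //; lra.
  have /near_ballP[rho rhop H] := filterI_near H1 H2.
  exists (Num.min rho r0); first by rewrite lt_min rhop r00 ge_min lexx orbT.
  move=> w Bw; have [|? ?] := H w; last exact/andP.
  by apply: le_ball Bw; rewrite ge_min lexx.
have Bsub w : ball w0 rho w -> ball w0 r0 w by exact: le_ball.
have K w : exists t, ball w0 rho w ->
    `|a - t| <= r0 / 2 /\ F (ins i w t) = 0.
  (* Off the ball the claim is vacuous and 0 is a default value. *)
  have [Bw|nBw] := pselect (ball w0 rho w); last by exists 0.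
  have /andP[F1 F2] := Hrho w Bw.
  have [||||||t t1 t2] := root w (a - r0 / 2) (a + r0 / 2); rewrite ?ltW//.
  - exact: Bsub.
  - by lra.
  by exists t => _; split=> //; rewrite ler_norml; lra.
have [g Hg] := choice K.
have g1 w : ball w0 rho w -> `|a - g w| < r0.
  by move=> /Hg[h _]; apply: le_lt_trans h _; lra.
have g2 w : ball w0 rho w -> F (ins i w (g w)) = 0 by move=> /Hg[].
have Bg w : ball w0 rho w -> ball x0 r0 (ins i w (g w)).
  by move=> Bw; apply/ball_ins => //; split; [exact: Bsub|exact: g1].
have guniq w t t' : ball w0 rho w -> `|a - t| < r0 -> `|a - t'| < r0 ->
    F (ins i w t) < F (ins i w t') -> t < t'.
  move=> Bw ht ht' Ftt; rewrite ltNge; apply/negP; rewrite le_eqVlt => /orP[/eqP E|tt].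
    by rewrite E ltxx in Ftt.
  by have := mono w t' t (Bsub _ Bw) ht' ht tt; rewrite ltNge (ltW Ftt).
have gw0 : g w0 = a.
  have Bw0r : ball w0 rho w0 by exact: ballxx.
  have G0 := g2 _ Bw0r; apply/eqP; rewrite eq_le !leNgt; apply/andP; split; apply/negP.
    by move=> /(mono w0 _ _ Bw0 h0 (g1 _ Bw0r)); rewrite x0E Fx0 G0 ltxx.
  by move=> /(mono w0 _ _ Bw0 (g1 _ Bw0r) h0); rewrite x0E Fx0 G0 ltxx.
have oB : open (ball w0 rho) by exact: ball_open.
have cg w : ball w0 rho w -> {for w, continuous g}.
  move=> Bw; apply/continuous_distP => e e0.
  have G1 := g1 w Bw; have G2 := g2 w Bw.
  (* Small enough that the heights [g w - e'] and [g w + e'] stay in the box. The signs of [F] there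
     persist near [w], which traps [g w'] between them. *)
  pose e' := Num.min (e / 2) ((r0 - `|a - g w|) / 2).
  have e'0 : 0 < e' by rewrite lt_min !divr_gt0//; lra.
  have e'e : e' <= e / 2 by rewrite ge_min lexx.
  have e'r : e' <= (r0 - `|a - g w|) / 2 by rewrite ge_min lexx orbT.
  have hgp : `|a - (g w + e')| < r0.
    by move: G1 e'r; case: (ger0P (a - g w)) => ? ? ?; rewrite ltr_norml; lra.
  have hgm : `|a - (g w - e')| < r0.
    by move: G1 e'r; case: (ger0P (a - g w)) => ? ? ?; rewrite ltr_norml; lra.
  have H1 : \forall w' \near w, 0 < F (ins i w' (g w + e')).
    apply: continuous_gt; first by apply: cins => //; exact: Bsub.
    by rewrite -G2; apply: mono => //; [exact: Bsub|lra].
  have H2 : \forall w' \near w, F (ins i w' (g w - e')) < 0.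
    apply: continuous_lt; first by apply: cins => //; exact: Bsub.
    by rewrite -[ltRHS]G2; apply: mono => //; [exact: Bsub|lra].
  have H3 : \forall w' \near w, ball w0 rho w' by exact: open_nbhs_nbhs.
  apply: (@filterS _ _ (nbhs_filter w) _ _ _ (filterI_near (filterI_near H1 H2) H3)).
  move=> w' [[/= h1 h2] h3]; rewrite ltr_norml.
  have : g w' < g w + e' by apply: (guniq w') => //; [exact: g1|rewrite g2].
  have : g w - e' < g w' by apply: (guniq w') => //; [exact: g1|rewrite g2].
  by lra.
have cins_g w : ball w0 rho w -> {for w, continuous (fun w => ins i w (g w))}.
  by move=> Bw; apply: ins_continuous_at; [exact: cvg_id|exact: cg].
have isd w j : ball w0 rho w -> is_derive w (delta_mx 0 j) g
    (- (pd (lift i j) F (ins i w (g w)) / pd i F (ins i w (g w)))).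
  move=> Bw; set x := ins i w (g w); set D := - _.
  have Bx : ball x0 r0 x by exact: Bg.
  have Wx : W x by have [] := Hr _ Bx.
  have cP l : {for x, continuous (pd l F)} by exact: Ck_on_continuous (Ck_on_pd l HF) Wx.
  (* Two arguments, since [mvt_box] evaluates the two partial derivatives at different points; both
     tend to [x]. *)
  pose Q (p : 'rV[R]_d.+1 * 'rV[R]_d.+1) := - (pd (lift i j) F p.1 / pd i F p.2).
  have cQ : {for (x, x), continuous Q}.
    apply: continuousN; apply: continuousM.
      by apply: (@continuous_comp _ _ _ fst (pd (lift i j) F)); [exact: cvg_fst|exact: cP].
    apply: continuousV; first by rewrite gt_eqF// F'0.
    by apply: (@continuous_comp _ _ _ snd (pd i F)); [exact: cvg_snd|exact: cP].
  apply: is_derive_cvg; apply/cvgrPdist_lt => e e0.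
  have /continuous_distP/(_ _ e0)/nbhs_ballP[s1 /= s10 Hs1] := cQ.
  have [s2 s20 Hs2] : exists2 s, 0 < s & ball x s `<=` ball x0 r0.
    by apply/near_ballP/open_nbhs_nbhs; split=> //; exact: ball_open.
  pose s := Num.min s1 s2.
  have s0 : 0 < s by rewrite lt_min s10 s20.
  have line : {for (0 : R), continuous (fun h : R => h *: (delta_mx 0 j : 'rV[R]_d) + w)}.
    apply: continuousD; last exact: cst_continuous.
    exact: scalel_continuous.
  have H1 : \forall h \near (0 : R), ball x s (ins i (h *: delta_mx 0 j + w) (g (h *: delta_mx 0 j + w))).
    have : {for (0 : R), continuous ((fun w => ins i w (g w)) \o (fun h : R => h *: (delta_mx 0 j : 'rV[R]_d) + w))}.
      apply: continuous_comp => //=; rewrite scale0r add0r; exact: cins_g.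
    move=> /continuous_ballP/(_ _ s0); rewrite /= scale0r add0r; exact.
  have H2 : \forall h \near (0 : R), ball w0 rho (h *: delta_mx 0 j + w).
    have := line; rewrite /prop_for /continuous_at scale0r add0r; apply.
    exact: open_nbhs_nbhs.
  apply: (@filterS _ _ (nbhs_filter (0 : R)) _ _ _ (filterI_near H1 H2)).
  move=> h [/= h1 h2] hn0.
  set w' := h *: _ + w in h1 h2 *.
  have [||| xi xi1 E] := @mvt_box R d.+1 F x s x (ins i w' (g w')).
  - move=> y l By; have [|Wy _] := Hr y; last exact: Ck_on_derivable HF Wy.
    by apply: Hs2; apply: le_ball By; rewrite ge_min lexx orbT.
  - exact: ballxx.
  - by [].
  (* Both endpoints lie on [F = 0] and differ only in coordinates [i] and [lift i j], so two terms
     remain and their sum is zero: the difference quotient of [g] is a value of [Q]. *)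
  move: E; rewrite g2// g2// subrr (bigD1_ord i)//= !ins_at.
  rewrite (bigD1 j)//= big1 ?addr0 => [|l lj]; last first.
    by rewrite !ins_lift !mxE (negbTE lj) eqxx/= mulr0 add0r subrr mul0r.
  rewrite !ins_lift !mxE !eqxx/= mulr1 addrK => E.
  have P0 : pd i F (xi i) != 0.
    by rewrite gt_eqF// F'0//; apply: Hs2; apply: le_ball (xi1 i); rewrite ge_min lexx orbT.
  have -> : h^-1 *: (g w' - g w) = Q (xi (lift i j), xi i).
    rewrite /Q; apply: (mulfI hn0); apply: (mulIf P0).
    rewrite [h^-1 *: _]/(h^-1 * _) mulVKf// mulrN mulNr -mulrA divfK//.
    by apply/eqP; rewrite -addr_eq0 -E.
  apply: Hs1; split => /=; [have := xi1 (lift i j)|have := xi1 i];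
    by apply: le_ball; rewrite ge_min lexx.
exists r0, rho; first by rewrite rho0 rhor.
exists g; split=> //=; first by split=> [x /Hr[]|//].
split.
- have W' : open (ball x0 r0) by exact: ball_open.
  have HF' : Ck_on k.+1 (ball x0 r0) F by apply: Ck_on_sub HF => x /Hr[].
  (* Bootstrap: if [g] is of class [l], the formula for its partial derivatives is of class [l], so
     [g] gains one order, up to the regularity of [F]. *)
  suff H l : (l <= k.+1)%N -> Ck_on l (ball w0 rho) g by exact: H.
  elim: l => [_|l IH lk]; first by apply/Ck_on0.
  apply/Ck_onS; split=> // [w j /(isd w j)[]//|j].
  have Hg' := IH (ltnW lk).
  have Hc (P : 'rV[R]_d.+1 -> R) : Ck_on l (ball x0 r0) P -> Ck_on l (ball w0 rho) (P \o (fun w => ins i w (g w))).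
    move=> HP; apply: (Ck_on_comp oB W' Bg HP) => j'.
    by apply: Ck_on_ins => // j''; exact: Ck_on_coord.
  have Hp l' : Ck_on l (ball x0 r0) (pd l' F).
    by apply: Ck_on_pd; apply: Ck_onW HF'.
  have H := Ck_onN oB (Ck_onM oB (Hc _ (Hp (lift i j))) (Hc _ (Ck_onV W' _ (Hp i)))).
  apply: Ck_on_eq oB _ (H _) => [w Bw|x Bx]; last by rewrite gt_eqF// F'0.
  by have [_ /= ->] := isd w j Bw.
- by move=> w j Bw; have [_ /= ->] := isd w j Bw.
Qed.

End ImplicitFunction.

(** * Parametric integrals *)

Section UnitIntervalIntegral.
Context {R : realType}.
Local Notation mu := (@lebesgue_measure R).

Definition I01 (f : R -> R) : R := \int[mu]_(s in `[0, 1]) f s.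

Lemma integrable01 (f : R -> R) : {within `[0, 1], continuous f} ->
  mu.-integrable `[0, 1] (EFin \o f).
Proof. by move=> cf; apply: continuous_compact_integrable => //; exact: segment_compact. Qed.

Lemma within01M (f g : R -> R) :
  {within `[0, 1], continuous f} -> {within `[0, 1], continuous g} ->
  {within `[0, 1], continuous (fun s => f s * g s)}.
Proof. by move=> cf cg x; exact: cvgM (cf x) (cg x). Qed.

Lemma within01B (f g : R -> R) :
  {within `[0, 1], continuous f} -> {within `[0, 1], continuous g} ->
  {within `[0, 1], continuous (fun s => f s - g s)}.
Proof. by move=> cf cg x; exact: cvgB (cf x) (cg x). Qed.

Lemma within01_cst (c : R) : {within `[0, 1], continuous (fun _ : R => c)}.
Proof. by move=> x; exact: cst_continuous. Qed.

Lemma I01_lin (h : R) (f g : R -> R) :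
  {within `[0, 1], continuous f} -> {within `[0, 1], continuous g} ->
  I01 (fun s => h * (f s - g s)) = h * (I01 f - I01 g).
Proof.
move=> cf cg; rewrite /I01 RintegralZl//; last first.
  exact/integrable01/within01B.
by rewrite RintegralB//; exact: integrable01.
Qed.

Lemma le_I01 (f g : R -> R) :
  {within `[0, 1], continuous f} -> {within `[0, 1], continuous g} ->
  (forall s, 0 <= s <= 1 -> f s <= g s) -> I01 f <= I01 g.
Proof.
by move=> cf cg fg; exact: (le_Rintegral _ (integrable01 cf) (integrable01 cg)).
Qed.

Lemma I01_cst (c : R) : I01 (fun=> c) = c.
Proof.
rewrite /I01 -[fun=> c]/(cst c) Rintegral_cst//= lebesgue_measure_itv/=.
by rewrite lte_fin ltr01 oppr0 adde0 mulr1.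
Qed.

Lemma I01_dist (f g : R -> R) e :
  {within `[0, 1], continuous f} -> {within `[0, 1], continuous g} ->
  (forall s, 0 <= s <= 1 -> `|f s - g s| <= e) -> `|I01 f - I01 g| <= e.
Proof.
move=> cf cg fg.
have cfg : {within `[0, 1], continuous (fun s => 1 * (f s - g s))}.
  by apply: within01M; [exact: within01_cst|exact: within01B].
rewrite -[I01 f - _]mul1r -I01_lin// ler_norml; apply/andP; split.
  rewrite -[leLHS]I01_cst; apply: le_I01 => //; first exact: within01_cst.
  move=> s /fg.
  by rewrite ler_norml mul1r => /andP[].
rewrite -[leRHS]I01_cst; apply: le_I01 => //; first exact: within01_cst.
move=> s /fg.
by rewrite ler_norml mul1r => /andP[].
Qed.

Lemma within_continuous01 (f : R -> R) :
  (forall s : R, 0 <= s <= 1 -> {for s, continuous f}) ->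
  {within `[0, 1], continuous f}.
Proof.
move=> H; apply: continuous_in_subspaceT => s; rewrite inE/= in_itv/=.
exact: H.
Qed.

(** The primitive of [(1 - s) * u2 s] is [(1 - s) * u1 s + u s]; its increment over the unit
    interval is the remainder. *)
Lemma taylor_I01 (u u1 u2 : R -> R) :
  (forall s : R, 0 <= s <= 1 -> is_derive s 1 u (u1 s)) ->
  (forall s : R, 0 <= s <= 1 -> is_derive s 1 u1 (u2 s)) ->
  {within `[0, 1], continuous u2} ->
  u 1 = u 0 + u1 0 + I01 (fun s => (1 - s) * u2 s).
Proof.
move=> H1 H2 cu2.
pose F (s : R) := (1 - s) * u1 s + u s.
have dF (s : R) : 0 <= s <= 1 -> is_derive s 1 F ((1 - s) * u2 s).
  move=> hs; have d1 := H1 s hs; have d2 := H2 s hs.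
  have d3 : is_derive s 1 (fun s : R => 1 - s) (- 1).
    have := @is_deriveB R R R (cst 1) id s 1 0 1 (is_derive_cst _ _ _) (is_derive_id _ _).
    by rewrite sub0r.
  have d4 := is_deriveM d3 d2.
  apply: is_derive_eq (is_deriveD d4 d1) _.
  by rewrite /GRing.scale/=; ring.
have cF (s : R) : 0 <= s <= 1 -> {for s, continuous F}.
  move=> /dF[/derivable1_diffP dFs _].
  exact: differentiable_continuous.
have cI : {within `[0, 1], continuous (fun s => (1 - s) * u2 s)}.
  apply: within01M cu2; apply: within01B; first exact: within01_cst.
  by apply: continuous_subspaceT => ?; exact: cvg_id.
have dF' : derivable_oo_LRcontinuous F 0 1.
  split=> [s||].
  - by rewrite in_itv/= => /andP[h1 h2]; have [] // := dF s; rewrite !ltW.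
  - by apply: cvg_at_right_filter; apply: cF; rewrite lexx ler01.
  - by apply: cvg_at_left_filter; apply: cF; rewrite lexx ler01.
have F' : {in `]0, 1[, F^`()%classic =1 (fun s => (1 - s) * u2 s)}.
  move=> s; rewrite in_itv/= => /andP[h1 h2].
  by rewrite derive1E; have [|_ ->] := dF s; rewrite // !ltW.
have E : I01 (fun s => (1 - s) * u2 s) = F 1 - F 0.
  by rewrite /I01 /Rintegral (continuous_FTC2 ltr01 cI dF' F').
rewrite E /F subrr mul0r add0r subr0 mul1r; ring.
Qed.

(** Taylor's formula read backwards for the quadratic function whose second derivative is [c]. *)
Lemma I01_weight (c : R) : I01 (fun s => (1 - s) * c) = c / 2.
Proof.
have lin (k s : R) : is_derive s 1 (fun s => k * s) k.
  apply: is_derive_eq (is_deriveM (is_derive_cst k s 1) (is_derive_id s 1)) _.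
  by rewrite /GRing.scale/= mulr1 mulr0 addr0.
have quad (s : R) : is_derive s 1 (fun s => c / 2 * s * s) (c * s).
  apply: is_derive_eq (is_deriveM (lin (c / 2) s) (is_derive_id s 1)) _.
  by rewrite /GRing.scale/=; field.
have := @taylor_I01 _ _ (fun=> c) (fun s _ => quad s) (fun s _ => lin c s).
rewrite !mulr0 !mulr1 !add0r => <- //; exact: within01_cst.
Qed.

End UnitIntervalIntegral.

(** * Differentiation under the integral sign *)

Section ParametricIntegral.
Context {R : realType}.

Lemma ins_addl d (i : 'I_d.+1) (w : 'rV[R]_d) t h j :
  ins i (h *: delta_mx 0 j + w) t = ins i w t + h *: delta_mx 0 (lift i j).
Proof.
apply/rowP => l; case: (unliftP i l) => [l' ->|->].
  by rewrite ins_lift !mxE liftK eqxx/= (inj_eq (@lift_inj _ i)) addrC.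
by rewrite ins_at !mxE unlift_none eqxx/= (negbTE (neq_lift _ _)) mulr0 addr0.
Qed.

Lemma minmax_norm (h t : R) :
  Num.min 0 h <= t <= Num.max 0 h -> `|t| <= `|h|.
Proof.
by case: (leP 0 h) => h0 ht; [rewrite (ger0_norm h0)|rewrite (ltr0_norm h0)];
  rewrite ler_norml; lra.
Qed.

Variables (n : nat) (i : 'I_n.+1) (U : set 'rV[R]_n) (V : set 'rV[R]_n.+1).
Hypothesis oU : open U.
Hypothesis UV : forall x s, U x -> 0 <= s <= 1 -> V (ins i x s).

(** Compactness of the unit interval makes continuity in the parameter [y] uniform in [s]. *)
Lemma uniform_near (G : 'rV[R]_n.+1 -> R) x e :
  Ck_on 0 V G -> U x -> 0 < e ->
  \forall y \near x, forall s, 0 <= s <= 1 -> `|G (ins i y s) - G (ins i x s)| < e.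
Proof.
move=> /Ck_on0 cG Ux e0.
have e20 : 0 < e / 2 by rewrite divr_gt0.
have /compact_near_coveringP K := @segment_compact R 0 1.
have := K _ (nbhs x) (fun y s => `|G (ins i y s) - G (ins i x s)| < e) (nbhs_filter x).
have H : forall s, (`[0%R, 1%R]%classic : set R) s ->
    \forall s' \near s & y \near x, `|G (ins i y s') - G (ins i x s')| < e.
  move=> s /=; rewrite in_itv/= => hs.
  (* Both [G (ins i y s')] and [G (ins i x s')] are compared with [G (ins i x s)], each within
     [e / 2]. *)
  have c1 : {for (s, x), continuous (fun p : R * 'rV[R]_n => G (ins i p.2 p.1))}.
    apply: continuous_comp; last by apply: cG; exact: UV.
    by apply: ins_continuous_at; [exact: cvg_snd|exact: cvg_fst].
  have c2 : {for (s, x), continuous (fun p : R * 'rV[R]_n => G (ins i x p.1))}.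
    apply: continuous_comp; last by apply: cG; exact: UV.
    by apply: ins_continuous_at; [exact: cst_continuous|exact: cvg_fst].
  have /continuous_distP/(_ _ e20) H1 := c1.
  have /continuous_distP/(_ _ e20) H2 := c2.
  have H12 := filterI_near H1 H2.
  apply: (@filterS _ _ (nbhs_filter (s, x)) _ _ _ H12) => -[s' y] /= [].
  by rewrite !ltr_norml; lra.
move=> /(_ H); apply: (@filterS _ _ (nbhs_filter x)) => y Hy s hs.
by apply: Hy; rewrite /= in_itv.
Qed.

Lemma ins_slice_continuous (G : 'rV[R]_n.+1 -> R) x :
  Ck_on 0 V G -> U x -> {within `[0, 1], continuous (fun s => G (ins i x s))}.
Proof.
move=> /Ck_on0 cG Ux; apply: within_continuous01 => s hs.
apply: continuous_comp; last by apply: cG; exact: UV.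
by apply: ins_continuous_at; [exact: cst_continuous|exact: cvg_id].
Qed.

Definition pint (G : 'rV[R]_n.+1 -> R) x := I01 (fun s => G (ins i x s)).

Lemma pint_continuous (G : 'rV[R]_n.+1 -> R) x :
  Ck_on 0 V G -> U x -> {for x, continuous (pint G)}.
Proof.
move=> cG Ux; apply/continuous_distP => e e0.
have e20 : 0 < e / 2 by rewrite divr_gt0.
have H1 := uniform_near cG Ux e20.
have H2 : \forall y \near x, U y by exact: open_nbhs_nbhs.
apply: (@filterS _ _ (nbhs_filter x) _ _ _ (filterI_near H1 H2)) => y [Hy Uy].
rewrite distrC; apply: (@le_lt_trans _ _ (e / 2)); last by lra.
apply: I01_dist; [exact: ins_slice_continuous|exact: ins_slice_continuous|].
by move=> s /Hy/ltW.
Qed.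

(** For each [s] the difference quotient is a partial derivative at a nearby parameter, by the mean
    value theorem; [uniform_near] bounds its distance to the limit uniformly in [s]. *)
Lemma pint_is_derive (G : 'rV[R]_n.+1 -> R) x j :
  Ck_on 1 V G -> U x ->
  is_derive x (delta_mx 0 j) (pint G) (pint (pd (lift i j) G) x).
Proof.
move=> cG Ux; apply: is_derive_cvg; apply/cvgrPdist_lt => e e0.
have e20 : 0 < e / 2 by rewrite divr_gt0.
have cG0 : Ck_on 0 V G by exact: Ck_onW cG.
have cG' : Ck_on 0 V (pd (lift i j) G) by exact: Ck_on_pd.
have H1 := uniform_near cG' Ux e20.
have H2 : \forall y \near x, U y by exact: open_nbhs_nbhs.
have /near_ballP[r r0 Hr] := filterI_near H1 H2.
apply/nbhs_ballP; exists r => //= h; rewrite -ball_normE/= sub0r normrN => hr h0.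
have Bx s : `|s| <= `|h| -> ball x r (s *: delta_mx 0 j + x).
  move=> sh; apply/rV_ballP => // l; rewrite !mxE opprD addrCA subrr addr0 normrN.
  by rewrite eqxx/=; case: eqP => _; rewrite ?mulr0 ?normr0// mulr1; exact: le_lt_trans hr.
have Uh : U (h *: delta_mx 0 j + x) by have [] := Hr _ (Bx h (lexx _)).
have E : h^-1 *: (pint G (h *: delta_mx 0 j + x) - pint G x) = I01 (fun s =>
    h^-1 * (G (ins i (h *: delta_mx 0 j + x) s) - G (ins i x s))).
  by rewrite I01_lin//; exact: ins_slice_continuous.
rewrite E distrC; apply: (@le_lt_trans _ _ (e / 2)); last by lra.
apply: I01_dist; last 1 first.
- move=> s hs; rewrite ins_addl.
  have [|t ht ->] := @mvt_axis R n.+1 G (ins i x s) (lift i j) h.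
    move=> t ht; rewrite -ins_addl; apply: Ck_on_derivable cG _; apply: UV => //.
    by have [] := Hr _ (Bx t (minmax_norm ht)).
  rewrite mulrA mulVf// mul1r -ins_addl; apply/ltW.
  by have [+ _] := Hr _ (Bx t (minmax_norm ht)); exact.
- apply: within01M; first exact: within01_cst.
  by apply: within01B; [exact: (ins_slice_continuous cG0 Uh)|exact: (ins_slice_continuous cG0 Ux)].
- exact: (ins_slice_continuous cG' Ux).
Qed.

Lemma Ck_on_pint k (G : 'rV[R]_n.+1 -> R) : Ck_on k V G -> Ck_on k U (pint G).
Proof.
elim: k G => [|k IH] G cG.
  by apply/Ck_on0 => x; exact: pint_continuous.
have cG1 : Ck_on 1 V G by exact: Ck_onW cG.
apply/Ck_onS; split=> [x|x j Ux|j].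
- by apply: pint_continuous; exact: Ck_onW cG.
- by have [] := pint_is_derive j cG1 Ux.
- apply: Ck_on_eq oU _ (IH _ (Ck_on_pd (lift i j) cG)) => x Ux.
  by have [_ /= ->] := pint_is_derive j cG1 Ux.
Qed.

End ParametricIntegral.

(** * Splitting off one square *)

Section SchurComplement.
Context {F : fieldType}.

Lemma mxrank_perm n (s t : 'S_n) (A : 'M[F]_n) :
  \rank (row_perm s (col_perm t A)) = \rank A.
Proof.
rewrite row_permE col_permE.
rewrite (eqmxMfull _ (_ : row_full (perm_mx s))); last first.
  by rewrite row_full_unit unitmx_perm.
by rewrite mxrankMfree// row_free_unit unitmx_perm.
Qed.

(** Block elimination: the outer factors [L] and [T] are unitriangular, so only the block diagonal
    factor counts for the rank. *)
Lemma mxrank_block_schur n (a : F) (u : 'rV[F]_n) (v : 'cV[F]_n) (D : 'M[F]_n) :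
  a != 0 -> \rank (block_mx a%:M u v D) = (\rank (D - a^-1 *: (v *m u))).+1.
Proof.
move=> a0; pose L : 'M[F]_(1 + n) := block_mx 1%:M 0 (a^-1 *: v) 1%:M.
pose T : 'M[F]_(1 + n) := block_mx 1%:M (a^-1 *: u) 0 1%:M.
have -> : block_mx a%:M u v D =
    L *m block_mx (a%:M : 'M[F]_1) 0 0 (D - a^-1 *: (v *m u)) *m T.
  rewrite /L /T !mulmx_block !(mul1mx, mulmx1, mulmx0, mul0mx, addr0, add0r).
  rewrite mul_scalar_mx mul_mx_scalar !scalerA mulfV// !scale1r.
  by rewrite -scalemxAr addrC subrK.
rewrite mxrankMfree; last first.
  by rewrite row_free_unit unitmxE det_ublock !det1 mulr1 unitr1.
rewrite (eqmxMfull _ (_ : row_full L)); last first.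
  by rewrite row_full_unit unitmxE det_lblock !det1 mulr1 unitr1.
rewrite rank_diag_block_mx mxrank_unit ?add1n//.
by rewrite unitmxE det_scalar expr1 unitfE.
Qed.

(** The same permutation of rows and columns, sending [ord0] to [i] and keeping the order of the
    other indices, brings the pivot to the corner. *)
Lemma mxrank_schur n (i : 'I_n.+1) (H : 'M[F]_n.+1) : H i i != 0 ->
  \rank H = (\rank (\matrix_(j < n, l < n) (H (lift i j) (lift i l)
               - H (lift i j) i * H i (lift i l) / H i i))).+1.
Proof.
move=> Hii; pose s : 'S_n.+1 := lift_perm ord0 i 1.
have s0 : s ord0 = i by exact: lift_perm_id.
have sl j : s (lift ord0 j) = lift i j by rewrite lift_perm_lift perm1.
rewrite -(mxrank_perm s s H).
pose u : 'rV[F]_n := \row_l H i (lift i l).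
pose v : 'cV[F]_n := \col_j H (lift i j) i.
pose D : 'M[F]_n := \matrix_(j, l) H (lift i j) (lift i l).
have -> : row_perm s (col_perm s H) = block_mx (H i i)%:M u v D :> 'M[F]_(1 + n).
  apply/matrixP => j l; rewrite !mxE.
  case: (@splitP 1 n j) => j' jE; rewrite !mxE; case: (@splitP 1 n l) => l' lE; rewrite !mxE.
  - have -> : j = ord0 by apply/val_inj; rewrite /= jE (ord1 j').
    have -> : l = ord0 by apply/val_inj; rewrite /= lE (ord1 l').
    by rewrite s0 (ord1 j') (ord1 l') eqxx mulr1n.
  - have -> : j = ord0 by apply/val_inj; rewrite /= jE (ord1 j').
    have -> : l = lift ord0 l' by apply/val_inj; rewrite /= lE.
    by rewrite s0 sl.
  - have -> : j = lift ord0 j' by apply/val_inj; rewrite /= jE.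
    have -> : l = ord0 by apply/val_inj; rewrite /= lE (ord1 l').
    by rewrite s0 sl.
  - have -> : j = lift ord0 j' by apply/val_inj; rewrite /= jE.
    have -> : l = lift ord0 l' by apply/val_inj; rewrite /= lE.
    by rewrite !sl.
rewrite mxrank_block_schur//; congr (\rank _).+1; apply/matrixP => j l.
by rewrite !mxE big_ord1 !mxE mulrC.
Qed.

End SchurComplement.

(** * Derivatives along graphs and axes *)

Section Graph.
Context {R : realType}.

Lemma pd_graph d (i : 'I_d.+1) (F : 'rV[R]_d.+1 -> R) (g : 'rV[R]_d -> R) w j :
  differentiable F (ins i w (g w)) -> differentiable g w ->
  pd j (F \o (fun w => ins i w (g w))) w =
  pd i F (ins i w (g w)) * pd j g w + pd (lift i j) F (ins i w (g w)).
Proof.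
move=> dF dg.
have E1 : (fun z => ins i z (g z) 0 i) = g by apply/funext => z; rewrite ins_at.
have E2 l : (fun z => ins i z (g z) 0 (lift i l)) = (fun z => z 0 l).
  by apply/funext => z; rewrite ins_lift.
have dG l : differentiable (fun z => ins i z (g z) 0 l) w.
  case: (unliftP i l) => [l' ->|->]; rewrite ?E1 ?E2//.
  exact: differentiable_coord.
rewrite derive_comp_rV// (bigD1_ord i)//= E1; congr (_ + _).
rewrite (bigD1 j)//= big1 ?addr0 => [|l lj]; rewrite E2.
  by have [_ ->] := is_derive_coord j j w; rewrite eqxx mulr1.
by have [_ ->] := is_derive_coord j l w; rewrite eq_sym (negbTE lj) mulr0.
Qed.

Lemma is_derive_axis d (i : 'I_d.+1) (F : 'rV[R]_d.+1 -> R) w (t c s : R) :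
  differentiable F (ins i w (t + s * c)) ->
  is_derive s 1 (fun s => F (ins i w (t + s * c))) (c * pd i F (ins i w (t + s * c))).
Proof.
move=> dF.
have E u : ins i w (t + u * c) = ins i w t + u *: (c *: delta_mx 0 i).
  by rewrite ins_addr scalerA.
have EF : (fun s => F (ins i w (t + s * c))) =
          (fun s => F (ins i w t + s *: (c *: delta_mx 0 i))).
  by apply/funext => u; rewrite E.
rewrite EF; rewrite E in dF *.
have dl : derivable F (ins i w t + s *: (c *: delta_mx 0 i)) (c *: delta_mx 0 i).
  exact: diff_derivable.
have H := is_derive_line dl.
suff <- : 'D_(c *: delta_mx 0 i) F (ins i w t + s *: (c *: delta_mx 0 i)) =
  c * pd i F (ins i w t + s *: (c *: delta_mx 0 i)) by [].
by rewrite /= !deriveE// linearZ.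
Qed.

(** A zero of a non-negative function is a minimum on the line through it parallel to axis [i]. *)
Lemma pd_at_zero m (W : set 'rV[R]_m) (f : 'rV[R]_m -> R) x i :
  open W -> W x -> (forall y, W y -> 0 <= f y) -> f x = 0 ->
  (forall y, W y -> derivable f y (delta_mx 0 i)) -> pd i f x = 0.
Proof.
move=> oW Wx f0 fx df.
have /near_ballP[r r0 Hr] : \forall y \near x, W y by exact: open_nbhs_nbhs.
have Wl h : h \in `](- r), r[ -> W (x + h *: delta_mx 0 i).
  rewrite in_itv/= -ltr_norml => hr.
  apply/Hr/rV_ballP => // l; rewrite !mxE opprD addNKr normrN eqxx/=.
  by case: eqP => _; rewrite ?mulr0 ?normr0// mulr1.
pose u t := f (x + t *: delta_mx 0 i).
have du h : h \in `](- r), r[ -> is_derive (h : R) 1 u (pd i f (x + h *: delta_mx 0 i)).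
  by move=> hr; apply: is_derive_line; exact/df/Wl.
have i0 : (0 : R) \in `](- r), r[ by rewrite in_itv/= oppr_lt0 r0.
have [||||_] := @derive1_at_min R u (- r) r 0.
- by lra.
- by move=> t /du[].
- by [].
- by move=> t /Wl/f0; rewrite /u scale0r addr0 fx.
by have [_ ->] := du _ i0; rewrite scale0r addr0.
Qed.

End Graph.

(** * Taylor's formula around the graph of critical points *)

Section SplitSquare.
Context {R : realType}.

Lemma open_preimage_on (S T : topologicalType) (A : set S) (B : set T) (h : S -> T) :
  open A -> open B -> (forall z, A z -> {for z, continuous h}) ->
  open [set z | A z /\ B (h z)].
Proof.
move=> oA oB ch; rewrite openE => z [Az Bz].
have H1 : \forall y \near z, A y by exact: open_nbhs_nbhs.
have H2 : \forall y \near z, B (h y) by apply: (ch z Az); exact: open_nbhs_nbhs.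
exact: filterI_near.
Qed.

Lemma I01Z (c : R) (f : R -> R) : {within `[0, 1], continuous f} ->
  I01 (fun s => c * f s) = c * I01 f.
Proof. by move=> cf; rewrite /I01 RintegralZl//; exact: integrable01. Qed.

(** The integrand is at least the weight times the minimum of [f], which is attained and hence
    positive. *)
Lemma I01_weight_gt0 (f : R -> R) : {within `[0, 1], continuous f} ->
  (forall s, 0 <= s <= 1 -> 0 < f s) -> 0 < I01 (fun s => (1 - s) * f s).
Proof.
move=> cf f0; have [c c01 Hc] := EVT_min ler01 cf.
have fc : 0 < f c by apply: f0; move: c01; rewrite in_itv.
have cw : {within `[0, 1], continuous (fun s : R => 1 - s)}.
  apply: within01B; first exact: within01_cst.
  by apply: continuous_subspaceT => ?; exact: cvg_id.
apply: (@lt_le_trans _ _ (I01 (fun s => (1 - s) * f c))).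
  by rewrite I01_weight divr_gt0.
apply: le_I01; [apply: within01M => //; exact: within01_cst|exact: within01M|].
move=> s s01; apply: ler_wpM2l; first by rewrite subr_ge0; case/andP: s01.
by apply: Hc; rewrite in_itv.
Qed.

Lemma convex_dist_lt (a b c s r : R) : `|a - b| < r -> `|a - c| < r ->
  0 <= s <= 1 -> `|a - (b + s * (c - b))| < r.
Proof.
move=> ab ac /andP[s0 s1]; pose M := Num.max `|a - b| `|a - c|.
have Mr : M < r by rewrite gt_max ab ac.
have : `|a - b| <= M by rewrite le_max lexx.
have : `|a - c| <= M by rewrite le_max lexx orbT.
rewrite !ler_norml => /andP[c1 c2] /andP[b1 b2]; apply: le_lt_trans Mr.
have s1' : 0 <= 1 - s by lra.
have h1 : 0 <= s * (M - (a - c)) by apply: mulr_ge0 => //; lra.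
have h2 : 0 <= s * ((a - c) + M) by apply: mulr_ge0 => //; lra.
have h3 : 0 <= (1 - s) * (M - (a - b)) by apply: mulr_ge0 => //; lra.
have h4 : 0 <= (1 - s) * ((a - b) + M) by apply: mulr_ge0 => //; lra.
by rewrite ler_norml; apply/andP; split; nra.
Qed.

(** The factor [q] is the integral of [1 - s] times the second derivative of [f] along axis [i], on
    the segment from the graph to [x]. It loses two orders of regularity, whereas [g] loses one. *)
Lemma split_square d (i : 'I_d.+1) m W (f : 'rV[R]_d.+1 -> R) x0 :
  open W -> W x0 -> Ck_on m.+2 W f -> pd i f x0 = 0 -> 0 < pder [:: i; i] f x0 ->
  exists (U : set 'rV[R]_d.+1) (B : set 'rV[R]_d) (g : 'rV[R]_d -> R)
    (q : 'rV[R]_d.+1 -> R),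
  let G := fun w => ins i w (g w) in
  [/\ open U /\ U x0, open B /\ (forall x, U x -> B (del i x)),
      (forall w, B w -> W (G w) /\ pd i f (G w) = 0) /\ G (del i x0) = x0,
      Ck_on m.+1 B g /\ (forall w j, B w -> pd j g w =
        - (pder [:: lift i j; i] f (G w) / pder [:: i; i] f (G w))) &
      [/\ Ck_on m U q, forall x, U x -> W x /\ 0 < q x &
       forall x, U x -> f x = f (G (del i x)) + (x 0 i - g (del i x)) ^+ 2 * q x]].
Proof.
move=> oW Wx0 Hf F0 F'0.
have HF : Ck_on m.+1 W (pd i f) by exact: Ck_on_pd.
have [r [rho /andP[rho0 rhor] [g [[rW rpos] Bg g0 gx0 [Hg g']]]]] :=
  implicit_scalar oW Wx0 HF F0 F'0.
have r0 : 0 < r by lra.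
pose w0 := del i x0; pose B := ball w0 rho; pose U := ball x0 rho.
have oB : open B by exact: ball_open.
have oU : open U by exact: ball_open.
have Ux0 : U x0 by exact: ballxx.
have UB x : U x -> B (del i x) /\ `|x0 0 i - x 0 i| < rho.
  by rewrite -{1}(ins_del i x) => /ball_ins; apply.
have UW x : U x -> W x by move=> Ux; apply: rW; exact: le_ball Ux.
(* The segment parallel to axis [i] from the graph ([s = 0]) to [x] ([s = 1]). *)
pose P (x : 'rV[R]_d.+1) (s : R) :=
  ins i (del i x) (g (del i x) + s * (x 0 i - g (del i x))).
have PW x s : U x -> 0 <= s <= 1 -> ball x0 r (P x s).
  move=> /UB[Bx xi] /andP[s0 s1]; apply/ball_ins => //; split.
    exact: le_ball Bx.
  have /ball_ins[//|_ xg] := Bg _ Bx.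
  by apply: convex_dist_lt => //; [exact: lt_le_trans rhor|rewrite s0].
(* The pair [(s, x)] is packed into one vector, [s] in coordinate [ord0], to fit the parametric
   integral [pint]. *)
pose Pz (z : 'rV[R]_d.+2) := P (del ord0 z) (z 0 ord0).
have oU' : open [set z : 'rV[R]_d.+2 | U (del ord0 z)].
  have -> : [set z : 'rV[R]_d.+2 | U (del ord0 z)] =
            [set z : 'rV[R]_d.+2 | setT z /\ U (del ord0 z)].
    by apply/seteqP; split=> z //= [].
  by apply: open_preimage_on => //; [exact: openT|move=> z _; exact: sel_continuous].
set U' := [set z | _] in oU'.
have Hdel l : Ck_on m.+1 U' (fun z => del ord0 z 0 l) by exact: Ck_on_sel.
have Hdel2 l : Ck_on m.+1 U' (fun z => del i (del ord0 z) 0 l).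
  rewrite (_ : (fun z => _) = (fun z => del ord0 z 0 (lift i l)))//.
  by apply/funext => z; rewrite delE.
have Hgd : Ck_on m.+1 U' (g \o (fun z => del i (del ord0 z))).
  by apply: (Ck_on_comp oU' oB _ Hg Hdel2) => z /UB[].
have HPz l : Ck_on m.+1 U' (fun z => Pz z 0 l).
  apply: Ck_on_ins => //; apply: Ck_onD => //; apply: Ck_onM => //.
    exact: Ck_on_coord.
  exact: Ck_onB.
pose V := [set z | U' z /\ ball x0 r (Pz z)].
have oV : open V.
  apply: open_preimage_on => //; first exact: ball_open.
  by move=> z Uz; apply/continuous_rVP => l; exact: Ck_on_continuous (HPz l) Uz.
pose K (z : 'rV[R]_d.+2) := (1 - z 0 ord0) * (pd i (pd i f) \o Pz) z.
have HK : Ck_on m V K.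
  apply: Ck_onM => //.
    by apply: Ck_onB => //; [exact: Ck_on_cst|exact: Ck_on_coord].
  apply: (@Ck_on_comp R _ _ m V (ball x0 r)) => //.
  - exact: ball_open.
  - by move=> z [].
  - by apply: Ck_on_sub rW _; exact: Ck_on_pd.
  - move=> l; apply: Ck_onW (leqnSn m) _; apply: Ck_on_sub (HPz l); by move=> z [].
have UV x s : U x -> 0 <= s <= 1 -> V (ins ord0 x s).
  move=> Ux hs; split; first by rewrite /U'/= del_ins.
  by rewrite /Pz del_ins ins_at; exact: PW.
exists U, B, g, (pint ord0 K).
have KE x s : K (ins ord0 x s) = (1 - s) * pd i (pd i f) (P x s).
  by rewrite /K /Pz/= del_ins ins_at.
have cP x : U x -> {within `[0, 1], continuous (fun s => pd i (pd i f) (P x s))}.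
  move=> Ux; apply: within_continuous01 => s hs.
  apply: continuous_comp.
    apply: ins_continuous_at; first exact: cst_continuous.
    apply: continuousD; first exact: cst_continuous.
    by apply: continuousM; [exact: cvg_id|exact: cst_continuous].
  apply: (@Ck_on_continuous _ _ _ m W); first exact: Ck_on_pd.
  exact/rW/PW.
split=> //.
- by split=> // x /UB[].
- split; last by rewrite gx0 ins_del.
  by move=> w Bw; split; [exact/rW/Bg|exact: g0].
split.
- exact: (Ck_on_pint oU UV HK).
- move=> x Ux; split; first exact: UW.
  rewrite /pint (_ : (fun s => _) = (fun s => (1 - s) * pd i (pd i f) (P x s))).
    apply: I01_weight_gt0; first exact: cP.
    by move=> s hs; apply: rpos; exact: PW.
  by apply/funext => s; rewrite KE.
- move=> x Ux; have [Bx _] := UB x Ux.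
  set c := x 0 i - g (del i x).
  have diff_at (h : 'rV[R]_d.+1 -> R) s : Ck_on m.+1 W h -> 0 <= s <= 1 -> differentiable h (P x s).
    by move=> Hh hs; apply: Ck_on_differentiable oW _ Hh; exact/rW/PW.
  have H1 (s : R) : 0 <= s <= 1 -> is_derive s 1 (fun s => f (P x s)) (c * pd i f (P x s)).
    by move=> hs; apply: is_derive_axis; apply: diff_at hs; exact: Ck_onW Hf.
  have H2 (s : R) : 0 <= s <= 1 ->
      is_derive s 1 (fun s => c * pd i f (P x s)) (c * (c * pd i (pd i f) (P x s))).
    move=> hs; have H := is_derive_axis (diff_at _ _ HF hs).
    apply: is_derive_eq (is_deriveM (is_derive_cst c s 1) H) _.
    by rewrite /GRing.scale/= mulr0 addr0.
  have cc : {within `[0, 1], continuous (fun s => c * (c * pd i (pd i f) (P x s)))}.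
    apply: within01M; first exact: within01_cst.
    by apply: within01M; [exact: within01_cst|exact: cP].
  have := taylor_I01 H1 H2 cc.
  have P1 : P x 1 = x by rewrite /P mul1r addrC subrK ins_del.
  have P0 : P x 0 = ins i (del i x) (g (del i x)) by rewrite /P mul0r addr0.
  (* The first order term vanishes because [pd i f] is zero on the graph; the chain rule supplies
     the factor [c] twice, whence the square. *)
  rewrite P1 P0 g0// mulr0 addr0 => ->; congr (_ + _).
  rewrite /pint -I01Z; last first.
    rewrite (_ : (fun s => _) = (fun s => (1 - s) * pd i (pd i f) (P x s))).
      apply: within01M; last exact: cP.
      apply: within01B; first exact: within01_cst.
      by apply: continuous_subspaceT => ?; exact: cvg_id.
    by apply/funext => s; rewrite KE.
  congr I01; apply/funext => s; rewrite KE -/c; ring.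
Qed.

End SplitSquare.

(** * Zeros of non-negative functions *)

Section HessianAtZero.
Context {R : realType}.

(** Two uses of the mean value theorem; the resulting constant is [e] rather than [e / 2], which is
    sharp enough below. *)
Lemma taylor2_axis m (f : 'rV[R]_m -> R) y i t e :
  (forall s, `|s| <= `|t| ->
    [/\ derivable f (y + s *: delta_mx 0 i) (delta_mx 0 i),
        derivable (pd i f) (y + s *: delta_mx 0 i) (delta_mx 0 i) &
        `|pder [:: i; i] f (y + s *: delta_mx 0 i)| <= e]) ->
  `|f (y + t *: delta_mx 0 i) - f y - t * pd i f y| <= e * t ^+ 2.
Proof.
move=> H.
have [s /minmax_norm hs|s /minmax_norm hs ->] := @mvt_axis R m f y i t.
  by have [] := H s hs.
rewrite -mulrBr.
have [s' /minmax_norm hs'|s' /minmax_norm hs' ->] := @mvt_axis R m (pd i f) y i s.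
  by have [] := H s' (le_trans hs' hs).
have [_ _ He] := H s' (le_trans hs' hs).
rewrite !normrM mulrA mulrC -real_normK ?num_real// expr2.
by apply: ler_pM => //; apply: ler_pM.
Qed.

Lemma two_thirds_lt (r : R) : 0 < r -> r / 3 + r / 3 < r.
Proof. by lra. Qed.

Lemma ge0_of_upper_bounds (a b c u v : R) :
  0 <= a -> b <= u -> a - b - c <= v -> 0 <= u + c + v.
Proof. by lra. Qed.

(** Taking the sign opposite to that of [h], the main term is [- s^2 |h| = - 4 e s^2], while the
    three errors add up to at most [3 e s^2]. *)
Lemma two_signs_absurd (s e h A : R) : 0 < s -> 0 < e -> e = `|h| / 4 ->
  `|A - s * h| <= s * e -> 0 <= e * s ^+ 2 + s * A + e * s ^+ 2 ->
  0 <= e * s ^+ 2 + - s * A + e * s ^+ 2 -> False.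
Proof.
move=> s0 e0 eE; rewrite ler_norml => /andP[A1 A2] S1 S2.
have es : 0 < s * s * e by rewrite !mulr_gt0.
have sA1 : 0 <= s * (A - s * h + s * e) by rewrite mulr_ge0 ?(ltW s0)//; lra.
have sA2 : 0 <= s * (s * e - (A - s * h)) by rewrite mulr_ge0 ?(ltW s0)//; lra.
have [hp|hn] := ler0P h.
  have eh : h = - 4 * e by rewrite eE (ler0_norm hp); field.
  by rewrite eh in sA1 sA2; rewrite expr2 in S1 S2; lra.
have eh : h = 4 * e by rewrite eE (gtr0_norm hn); field.
by rewrite eh in sA1 sA2; rewrite expr2 in S1 S2; lra.
Qed.

Variables (d : nat) (W : set 'rV[R]_d) (f : 'rV[R]_d -> R) (x0 : 'rV[R]_d).
Hypotheses (oW : open W) (Wx0 : W x0) (Hf : Ck_on 2 W f).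
Hypotheses (f0 : forall x, W x -> 0 <= f x) (fx0 : f x0 = 0).

Lemma grad_at_zero x i : W x -> f x = 0 -> pd i f x = 0.
Proof.
move=> Wx fx; apply: (pd_at_zero oW Wx f0 fx) => y Wy.
exact: Ck_on_derivable Hf Wy.
Qed.

Lemma ball_two_axes r s a b (j l : 'I_d) : 0 < r -> `|a| <= s -> `|b| <= s ->
  s + s < r -> ball x0 r (x0 + a *: delta_mx 0 j + b *: delta_mx 0 l).
Proof.
move=> r0 ha hb hs; apply/rV_ballP => // k; rewrite !mxE eqxx/=.
rewrite -!addrA opprD addNKr normrN; apply: le_lt_trans hs.
apply: le_trans (ler_normD _ _) _; apply: lerD; rewrite normrM.
  by case: (k == j); rewrite ?normr1 ?mulr1// normr0 mulr0 (le_trans _ ha).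
by case: (k == l); rewrite ?normr1 ?mulr1// normr0 mulr0 (le_trans _ hb).
Qed.

(** If the entry were negative, two mean values would give [f <= 0] at a point further along axis
    [i]. That point is then a zero, where [pd i f] must vanish, although the mean value theorem
    makes it negative. *)
Lemma hessian_diag_ge0 i : 0 <= pder [:: i; i] f x0.
Proof.
rewrite leNgt; apply/negP => H.
have H1 : \forall x \near x0, pder [:: i; i] f x < 0.
  by apply: continuous_lt => //; apply: Ck_on_continuous (Ck_on_pd i (Ck_on_pd i Hf)) Wx0.
have H2 : \forall x \near x0, W x by exact: open_nbhs_nbhs.
have /near_ballP[r r0 Hr] := filterI_near H1 H2.
pose t := r / 3; have t0 : 0 < t by rewrite divr_gt0.
have Bs s : `|s| <= `|t| -> ball x0 r (x0 + s *: delta_mx 0 i).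
  rewrite (gtr0_norm t0) => hs.
  have := @ball_two_axes r t s 0 i i r0 hs; rewrite scale0r addr0; apply.
    by rewrite normr0 ltW.
  exact: two_thirds_lt.
have mvt2 s : 0 <= s <= t -> exists2 s', pder [:: i; i] f (x0 + s' *: delta_mx 0 i) < 0 &
    pd i f (x0 + s *: delta_mx 0 i) = s * pder [:: i; i] f (x0 + s' *: delta_mx 0 i).
  move=> /andP[s0 st].
  have hst : `|s| <= `|t| by rewrite !ger0_norm// ltW.
  have [s' /minmax_norm hs'|s' /minmax_norm hs' E] := @mvt_axis R d (pd i f) x0 i s.
    have [_ Ws] := Hr _ (Bs _ (le_trans hs' hst)).
    exact: Ck_on_derivable (Ck_on_pd i Hf) Ws.
  exists s'; first by have [] := Hr _ (Bs _ (le_trans hs' hst)).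
  by move: E; rewrite (grad_at_zero i Wx0 fx0) subr0.
have ft : f (x0 + t *: delta_mx 0 i) = 0.
  have [s /minmax_norm hs|s hs] := @mvt_axis R d f x0 i t.
    by have [_ Ws] := Hr _ (Bs _ hs); exact: Ck_on_derivable Hf Ws.
  have {}hs : 0 <= s <= t by move: hs; rewrite (min_l (ltW t0)) (max_r (ltW t0)).
  have [s' n1 ->] := mvt2 s hs; rewrite fx0 subr0 => E.
  have [_ Wt] := Hr _ (Bs _ (lexx _)).
  apply/eqP; rewrite eq_le f0// andbT E pmulr_rle0//.
  by apply: mulr_ge0_le0; [case/andP: hs|exact: ltW].
have [_ Wt] := Hr _ (Bs _ (lexx _)).
have [|s' n1] := mvt2 t; first by rewrite lexx ltW.
rewrite (grad_at_zero i Wt ft) => /esym/eqP.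
by rewrite mulf_eq0 (gt_eqF t0)/= (lt_eqF n1).
Qed.

(* Moving by [s] along [j] and then by [-s] or [s] along [l] changes [f] by
   [- s^2 |H_jl| + o(s^2)] when both diagonal entries vanish. *)
Lemma hessian_diag_eq0 j l : pder [:: j; j] f x0 = 0 -> pder [:: l; l] f x0 = 0 ->
  pder [:: j; l] f x0 = 0.
Proof.
move=> Hjj Hll; apply/eqP/negP => /negP Hjl; set h := pder [:: j; l] f x0 in Hjl *.
pose e := `|h| / 4; have e0 : 0 < e by rewrite divr_gt0// normr_gt0.
have near_e a b : \forall x \near x0, `|pder [:: a; b] f x0 - pder [:: a; b] f x| < e.
  have : {for x0, continuous (pder [:: a; b] f)}.
    exact: Ck_on_continuous (Ck_on_pd a (Ck_on_pd b Hf)) Wx0.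
  by move=> /continuous_distP/(_ _ e0).
have H2 : \forall x \near x0, W x by exact: open_nbhs_nbhs.
have /near_ballP[r r0 Hr] := filterI_near (filterI_near (near_e j j) (near_e l l))
  (filterI_near (near_e j l) H2).
pose s := r / 3; have s0 : 0 < s by rewrite divr_gt0.
have sr : s + s < r by exact: two_thirds_lt.
have Bab a b : `|a| <= s -> `|b| <= s ->
    ball x0 r (x0 + a *: delta_mx 0 j + b *: delta_mx 0 l).
  by move=> ha hb; exact: (@ball_two_axes r s).
have Ba a : `|a| <= s -> ball x0 r (x0 + a *: delta_mx 0 j).
  by move=> ha; have := Bab a 0 ha; rewrite normr0 (ltW s0) scale0r addr0; apply.
have dd a b y : ball x0 r y -> derivable (pd a f) y (delta_mx 0 b).
  by move=> /Hr[_ [_ Wy]]; exact: Ck_on_derivable (Ck_on_pd a Hf) Wy.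
have d1 b y : ball x0 r y -> derivable f y (delta_mx 0 b).
  by move=> /Hr[_ [_ Wy]]; exact: Ck_on_derivable Hf Wy.
pose y := x0 + s *: delta_mx 0 j.
have fy : f y <= e * s ^+ 2.
  have := @taylor2_axis d f x0 j s e.
  rewrite fx0 (grad_at_zero j Wx0 fx0) mulr0 !subr0 => H.
  apply: le_trans (ler_norm _) (H _) => t; rewrite (gtr0_norm s0) => ht; split.
  - exact/d1/Ba.
  - exact/dd/Ba.
  - have [[+ _] _] := Hr _ (Ba _ ht).
    by rewrite Hjj sub0r normrN => /ltW.
have Ay : `|pd l f y - s * h| <= s * e.
  have [t /minmax_norm|t /minmax_norm] := @mvt_axis R d (pd l f) x0 j s.
    by rewrite (gtr0_norm s0) => ht; exact/dd/Ba.
  rewrite (gtr0_norm s0) (grad_at_zero l Wx0 fx0) subr0 => ht ->.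
  rewrite -mulrBr normrM (gtr0_norm s0) ler_wpM2l ?(ltW s0)// distrC.
  by have [_ [/ltW]] := Hr _ (Ba _ ht).
(* The first error bounds [f y], the second the Taylor remainder from [y] along [l]; their sum with
   the linear term dominates a value of [f]. *)
have step t : `|t| = s -> 0 <= e * s ^+ 2 + t * pd l f y + e * s ^+ 2.
  move=> ts; have ty : `|t| <= s by rewrite ts.
  have B : ball x0 r (y + t *: delta_mx 0 l) by apply: Bab; rewrite // gtr0_norm.
  have fz : 0 <= f (y + t *: delta_mx 0 l) by have [_ [_ Wz]] := Hr _ B; exact: f0.
  have := @taylor2_axis d f y l t e; rewrite ler_norml => H.
  have /andP[_] : - (e * t ^+ 2) <= f (y + t *: delta_mx 0 l) - f y - t * pd l f y <= e * t ^+ 2.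
    apply: H => u; rewrite ts => hu.
    have Bu : ball x0 r (y + u *: delta_mx 0 l) by apply: Bab; rewrite // gtr0_norm.
    split; [exact: d1|exact: dd|].
    have [[_ +] _] := Hr _ Bu.
    by rewrite Hll sub0r normrN => /ltW.
  rewrite -(real_normK (num_real t)) ts; exact: ge0_of_upper_bounds.
apply: (@two_signs_absurd s e h (pd l f y)) => //.
  exact/step/gtr0_norm.
by apply: step; rewrite normrN gtr0_norm.
Qed.

End HessianAtZero.

(** * Elimination of one variable per unit of rank *)

Section NormalForm.
Context {R : realType}.

Lemma hessianE d (f : 'rV[R]_d -> R) x j l : hessian f x j l = pd j (pd l f) x.
Proof. by rewrite mxE. Qed.

(** Otherwise the diagonal, being non-negative, is zero, and then every entry vanishes. *)
Lemma exists_hessian_diag_gt0 d (W : set 'rV[R]_d) (f : 'rV[R]_d -> R) x0 :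
  open W -> W x0 -> Ck_on 2 W f -> (forall x, W x -> 0 <= f x) -> f x0 = 0 ->
  hessian f x0 != 0 -> exists i, 0 < pder [:: i; i] f x0.
Proof.
move=> oW Wx0 Hf f0 fx0 /eqP Hn0; apply: contrapT => H; apply: Hn0.
have D i : pder [:: i; i] f x0 = 0.
  apply/eqP; rewrite eq_le (hessian_diag_ge0 oW Wx0 Hf f0 fx0) andbT leNgt.
  by apply/negP => Hi; apply: H; exists i.
by apply/matrixP => j l; rewrite !mxE; exact: (hessian_diag_eq0 oW Wx0 Hf f0 fx0).
Qed.

Lemma schur_entry (a b c e : R) : e - a * b / c = b * - (a / c) + e.
Proof. by rewrite mulrN mulrCA mulrA addrC. Qed.

Section Reduction.
Variables (d : nat) (i : 'I_d.+1) (m : nat) (W : set 'rV[R]_d.+1).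
Variables (f : 'rV[R]_d.+1 -> R) (B : set 'rV[R]_d) (g : 'rV[R]_d -> R).
Let G w := ins i w (g w).
Hypotheses (oW : open W) (oB : open B) (Hf : Ck_on m.+2 W f) (Hg : Ck_on m.+1 B g).
Hypothesis BW : forall w, B w -> W (G w) /\ pd i f (G w) = 0.

Lemma Ck_on_graph k (F : 'rV[R]_d.+1 -> R) : (k <= m.+1)%N ->
  Ck_on k W F -> Ck_on k B (F \o G).
Proof.
move=> km HF; apply: (Ck_on_comp oB oW _ HF) => [w /BW[]//|j].
by apply: Ck_on_ins => [j'|]; [exact: Ck_on_coord|exact: Ck_onW Hg].
Qed.

(* The term with [pd i f] drops out on the graph: the reduced function is
   therefore as regular as [f] although [g] has one derivative less. *)
Lemma pd_reduced w j : B w -> pd j (f \o G) w = pd (lift i j) f (G w).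
Proof.
move=> Bw; have [WG F0] := BW Bw; rewrite pd_graph.
- by rewrite [X in X * _]F0 mul0r add0r.
- exact: Ck_on_differentiable oW WG Hf.
- exact: Ck_on_differentiable oB Bw Hg.
Qed.

Lemma Ck_on_reduced : Ck_on m.+2 B (f \o G).
Proof.
have H1 : Ck_on m.+1 B (f \o G) by apply: Ck_on_graph => //; exact: Ck_onW Hf.
apply/Ck_onS; split=> [w Bw|w j Bw|j].
- exact: Ck_on_continuous H1 Bw.
- exact: Ck_on_derivable H1 Bw.
- have H : Ck_on m.+1 B (pd (lift i j) f \o G) by apply: Ck_on_graph => //; exact: Ck_on_pd.
  by apply: Ck_on_eq oB _ H => w Bw; rewrite pd_reduced.
Qed.

(** Differentiating [pd_reduced] once more and inserting the derivative of [g] gives exactly the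
    entries of the Schur complement. *)
Lemma hessian_reduced w : B w -> pd i (pd i f) (G w) != 0 ->
  (forall j, pd j g w = - (pd (lift i j) (pd i f) (G w) / pd i (pd i f) (G w))) ->
  \rank (hessian f (G w)) = (\rank (hessian (f \o G) w)).+1.
Proof.
move=> Bw n0 g'; rewrite (mxrank_schur (i := i)) ?hessianE//.
congr (\rank _).+1; apply/matrixP => j l; rewrite mxE !hessianE.
have [WG _] := BW Bw.
have -> : pd j (pd l (f \o G)) w = pd j (pd (lift i l) f \o G) w.
  by apply: near_eq_derive; apply: (open_near oB Bw) => y By; exact: pd_reduced.
rewrite pd_graph; last 2 first.
- exact: Ck_on_differentiable oW WG (Ck_on_pd _ Hf).
- exact: Ck_on_differentiable oB Bw Hg.
rewrite g'; exact: schur_entry.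
Qed.

End Reduction.

(** Induction on the rank, for all dimensions at once. The map [h] lists the surviving coordinates,
    and the graph of [sg] over them contains every zero of [f] in [U]. *)
Lemma normal_form r d m (W : set 'rV[R]_d) (f : 'rV[R]_d -> R) x0 :
  open W -> W x0 -> Ck_on m.+2 W f -> (forall x, W x -> 0 <= f x) -> f x0 = 0 ->
  \rank (hessian f x0) = r ->
  exists n (h : 'I_n -> 'I_d) (U : set 'rV[R]_d) (B : set 'rV[R]_n)
    (sg : 'rV[R]_n -> 'rV[R]_d) (fs : 'I_r -> 'rV[R]_d -> R),
  [/\ (n + r = d)%N, [/\ open U, U x0 & U `<=` W],
      open B /\ (forall x, U x -> B (sel h x)),
      (forall j, Ck_on m.+1 B (fun y => sg y 0 j)) /\
      (forall y, B y -> W (sg y) /\ sel h (sg y) = y) &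
      [/\ forall i, Ck_on m U (fs i),
          forall x, U x -> f x = f (sg (sel h x)) + \sum_i fs i x ^+ 2 &
          forall x, U x -> f x = 0 -> x = sg (sel h x)]].
Proof.
elim: r d W f x0 => [|r IH] d W f x0 oW Wx0 Hf f0 fx0 rk.
  (* In rank 0 nothing is eliminated: [f] itself is the remaining function. *)
  have selid (x : 'rV[R]_d) : sel id x = x by apply/rowP => j; rewrite mxE.
  exists d, id, W, W, id, (fun _ _ => 0); split.
  - by rewrite addn0.
  - by split.
  - by split=> // x Wx; rewrite selid.
  - by split=> [j|y Wy]; [exact: Ck_on_coord|rewrite selid].
  - split=> [[]//|x Wx|x _ _]; last by rewrite selid.
    by rewrite selid big_ord0 addr0.
have Hf2 : Ck_on 2 W f by exact: Ck_onW Hf.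
have [i Hi] : exists i, 0 < pder [:: i; i] f x0.
  apply: (exists_hessian_diag_gt0 oW) => //; apply/eqP => E.
  by move: rk; rewrite E mxrank0.
case: d W f x0 i oW Wx0 Hf f0 fx0 rk Hf2 Hi => [|d] W f x0 i; first by case: i.
move=> oW Wx0 Hf f0 fx0 rk Hf2 Hi.
have grad0 := grad_at_zero oW Hf2 f0 i Wx0 fx0.
have [U1 [B1 [g [q [[oU1 U1x0] [oB1 UB1] [BW Gx0] [Hg g'] [Hq q0 fq]]]]]] :=
  split_square oW Wx0 Hf grad0 Hi.
pose G w := ins i w (g w).
have B1x0 := UB1 _ U1x0.
have Gx0' : G (del i x0) = x0 := Gx0.
have rk2 : \rank (hessian (f \o G) (del i x0)) = r.
  have H : pd i (pd i f) (G (del i x0)) != 0 ->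
      (forall j, pd j g (del i x0) =
        - (pd (lift i j) (pd i f) (G (del i x0)) / pd i (pd i f) (G (del i x0)))) ->
      \rank (hessian f (G (del i x0))) = (\rank (hessian (f \o G) (del i x0))).+1.
    exact: (hessian_reduced oW oB1 Hf Hg BW B1x0).
  rewrite Gx0' rk in H; apply/esym/eq_add_S/H; first by rewrite gt_eqF.
  by move=> j; rewrite -{2 3}Gx0'; exact: g'.
have e0 w : B1 w -> 0 <= (f \o G) w by move=> /BW[/f0].
have ex0 : (f \o G) (del i x0) = 0 by rewrite /= Gx0'.
have [n [h [U2 [B2 [sg [fs [nr [oU2 U2x0 UB2] [oB2 hB2] [Hsg sgP] [Hfs fE fZ]]]]]]]] :=
  IH d B1 (f \o G) (del i x0) oB1 B1x0 (Ck_on_reduced oW oB1 Hf Hg BW) e0 ex0 rk2.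
have selE x : sel (lift i \o h) x = sel h (del i x) by apply/rowP => j; rewrite !mxE.
pose U := [set x | U1 x /\ U2 (del i x)].
have oU : open U by apply: open_preimage_on => // z _; exact: sel_continuous.
have UU1 : U `<=` U1 by move=> x [].
(* Index [ord0] carries the new square; the others come from the reduced function, pulled back along
   [del i]. *)
pose fs' (k : 'I_r.+1) x := if unlift ord0 k is Some k' then fs k' (del i x)
  else (x 0 i - g (del i x)) * Num.sqrt (q x).
exists n, (lift i \o h), U, B2, (fun y => G (sg y)), fs'.
have Hdel k l : Ck_on k U (fun x => del i x 0 l) by exact: Ck_on_sel.
have sqE x : U x -> fs' ord0 x ^+ 2 = (x 0 i - g (del i x)) ^+ 2 * q x.
  by move=> [Ux _]; rewrite /fs' unlift_none exprMn sqr_sqrtr// ltW//; have [] := q0 _ Ux.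
have fE' x : U x -> f x = f (G (sg (sel (lift i \o h) x))) + \sum_k fs' k x ^+ 2.
  move=> Ux; have [Ux1 Ux2] := Ux; rewrite selE big_ord_recl sqE// fq//.
  have /= -> := fE _ Ux2; rewrite -addrA; congr (_ + _); rewrite addrC.
  by congr (_ + _); apply: eq_bigr => k _; rewrite /fs' liftK.
split=> //.
- by rewrite addnS nr.
- by split=> // x /UU1/q0[].
- by split=> // x [_ Ux2]; rewrite selE; exact: hB2.
- split=> [j|y By].
    apply: Ck_on_ins => //.
    apply: (Ck_on_comp oB2 oB1 _ Hg Hsg) => y By.
    by have [] := sgP _ By.
  have [Bs sE] := sgP _ By; have [WG _] := BW _ Bs; split=> //.
  by rewrite selE /G del_ins.
- split=> // [k|x Ux fx].
    rewrite /fs'; case: (unlift ord0 k) => [k'|].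
      by apply: (Ck_on_comp oU oU2 _ (Hfs k')) => [x []//|l]; exact: Hdel.
    apply: Ck_onM => //.
      apply: Ck_onB => //; first exact: Ck_on_coord.
      apply: (Ck_on_comp oU oB1 _ (Ck_onW (leqnSn m) Hg)) => [x /UU1/UB1//|l].
      exact: Ck_on_sel.
    apply: Ck_on_sqrt => // [x /UU1/q0[]//|].
    exact: Ck_on_sub Hq.
  (* At a zero of [f] both non-negative summands vanish: the first puts [del i x] on the graph of
     the induction hypothesis, the second puts [x] on the graph of [g]. *)
  have [Ux1 Ux2] := Ux; have [Wx qx] := q0 _ Ux1.
  have := fq _ Ux1; rewrite fx => /esym/eqP.
  have p1 := e0 _ (UB1 _ Ux1); have p2 : 0 <= (x 0 i - g (del i x)) ^+ 2 * q x.
    by rewrite mulr_ge0 ?sqr_ge0 ?ltW.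
  rewrite paddr_eq0// => /andP[/eqP E1 /eqP/eqP].
  rewrite mulf_eq0 (gt_eqF qx) orbF sqrf_eq0 subr_eq0 => /eqP E2.
  by rewrite selE -(fZ _ Ux2 E1) /G -E2 ins_del.
Qed.

End NormalForm.

(** * Local surjectivity and the zero set *)

(** Gives matrices the joint structure of a complete normed module, in which Banach's fixed point
    theorem is applied. *)
HB.instance Definition _ (R : realType) m n := Complete.on 'M[R]_(m, n).

Section LocalSurjectivity.
Context {R : realType}.

(** By the chain rule the differential of [t] factors through that of [u]. *)
Lemma injective_diff (V W Z : normedModType R) (u : V -> W) (s : W -> Z) (t : V -> Z) x :
  differentiable u x -> differentiable s (u x) ->
  (\forall y \near x, s (u y) = t y) -> differentiable t x ->
  injective ('d t x) -> injective ('d u x).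
Proof.
move=> du ds st dt inj v w E; apply: inj.
have H c : 'd t x c = 'd s (u x) ('d u x c).
  rewrite -deriveE// -(near_eq_derive _ st).
  rewrite -[fun y => s (u y)]/(s \o u) deriveE; last exact: differentiable_comp.
  by rewrite diff_comp.
by rewrite !H E.
Qed.

Lemma row_free_jacobian n d (psi : 'rV[R]_n -> 'rV[R]_d) x :
  differentiable psi x -> injective ('d psi x) -> row_free (jacobian psi x).
Proof.
move=> dpsi inj; apply/inj_row_free => v; rewrite -deriveEjacobian// deriveE// => E.
by apply: inj; rewrite E linear0.
Qed.

Lemma jacobian_pd n d (psi : 'rV[R]_n -> 'rV[R]_d) x i j :
  differentiable psi x -> jacobian psi x i j = pd i (fun z => psi z 0 j) x.
Proof.
move=> dpsi; have := deriveEjacobian (delta_mx 0 i) dpsi.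
rewrite derive_mx; last exact: diff_derivable.
by rewrite -rowE => /rowP/(_ j); rewrite !mxE.
Qed.

(* Newton's map [z |-> z - (psi z - y) A^-1] with [A] the Jacobian at [0] is a
   contraction near [0], since its derivative at [0] vanishes. *)
Lemma local_surjection n (O : set 'rV[R]_n) (psi : 'rV[R]_n -> 'rV[R]_n) :
  open O -> O 0 -> (forall j, Ck_on 1 O (fun z => psi z 0 j)) ->
  injective ('d psi 0) ->
  exists2 e, 0 < e & forall y, ball (psi 0) e y -> exists2 z, O z & psi z = y.
Proof.
move=> oO O0 Hpsi inj.
have dpsij j : differentiable (fun z => psi z 0 j) 0.
  exact: Ck_on_differentiable oO O0 (Hpsi j).
have dpsi := differentiable_rV dpsij.
pose A := jacobian psi 0.
have uA : A \in unitmx by rewrite -row_free_unit; exact: row_free_jacobian.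
pose Phi z : 'rV[R]_n := z - psi z *m invmx A.
have PhiE j : (fun z => Phi z 0 j) =
    (fun z => z 0 j - \sum_l psi z 0 l * invmx A l j).
  by apply/funext => z; rewrite !mxE.
have HPhi j : Ck_on 1 O (fun z => Phi z 0 j).
  rewrite PhiE; apply: Ck_onB => //; first exact: Ck_on_coord.
  by apply: Ck_on_sum => // l; apply: Ck_onM => //; exact: Ck_on_cst.
have Phi'0 i j : pd i (fun z => Phi z 0 j) 0 = 0.
  rewrite PhiE /= deriveB; last 2 first.
  - by have [] := is_derive_coord i j (0 : 'rV[R]_n).
  - have H : Ck_on 1 O (fun z => \sum_l psi z 0 l * invmx A l j).
      by apply: Ck_on_sum => // l; apply: Ck_onM => //; exact: Ck_on_cst.
    exact: Ck_on_derivable H O0.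
  have [_ ->] := is_derive_coord i j (0 : 'rV[R]_n).
  have -> : 'D_(delta_mx 0 i) (fun z => \sum_l psi z 0 l * invmx A l j) 0 =
      \sum_l A i l * invmx A l j.
    have d1 l : derivable (fun z => psi z 0 l) 0 (delta_mx 0 i : 'rV[R]_n).
      exact: diff_derivable.
    have d2 l : derivable (fun z => psi z 0 l * invmx A l j) 0 (delta_mx 0 i : 'rV[R]_n).
      by apply: derivableM => //; exact: derivable_cst.
    rewrite -fct_sumE derive_sum//; apply: eq_bigr => l _.
    by rewrite /A jacobian_pd// [RHS]mulrC; exact: deriveMr.
  have -> : \sum_l A i l * invmx A l j = (A *m invmx A) i j by rewrite mxE.
  by rewrite mulmxV// mxE subrr.
(* With [n] partial derivatives below [eta], the map [Phi] has Lipschitz constant at most one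
   half. *)
pose eta : R := 2^-1 / n.+1%:R.
have eta0 : 0 < eta by rewrite divr_gt0// invr_gt0.
have [r r0 Hr] : exists2 r, 0 < r & forall z, ball 0 r z ->
    O z /\ forall i j, `|pd i (fun z => Phi z 0 j) z| < eta.
  apply/near_ballP/filterI_near; first exact: open_nbhs_nbhs.
  apply: (filter_forall (nbhs_filter (0 : 'rV[R]_n))) => i.
  apply: (filter_forall (nbhs_filter (0 : 'rV[R]_n))) => j.
  have : {for (0 : 'rV[R]_n), continuous (pd i (fun z => Phi z 0 j))}.
    exact: Ck_on_continuous (Ck_on_pd i (HPhi j)) O0.
  move=> /continuous_distP/(_ _ eta0).
  by rewrite Phi'0; apply: (filterS (F := nbhs (0 : 'rV[R]_n))) => z; rewrite sub0r normrN.
have lip a b : ball 0 r a -> ball 0 r b -> `|Phi b - Phi a| <= 2^-1 * `|b - a|.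
  move=> Ba Bb; apply: normr_rV_le => [|j]; first by rewrite mulr_ge0 ?invr_ge0.
  have [y i /Hr[Oy _]|//|//|xi xi1] := @mvt_box R n (fun z => Phi z 0 j) 0 r a b.
    exact: Ck_on_derivable (HPhi j) Oy.
  rewrite [in `|_|]mxE [(- Phi a) 0 j]mxE => ->.
  apply: le_trans (ler_norm_sum _ _ _) _.
  apply: (@le_trans _ _ (\sum_(i < n) `|b - a| * eta)).
    apply: ler_sum => i _; rewrite normrM; apply: ler_pM => //.
      by have := normr_rV_coord (b - a) i; rewrite !mxE.
    by have [_ /(_ i j)/ltW] := Hr _ (xi1 i).
  rewrite -mulr_sumr mulrC ler_wpM2r// sumr_const card_ord -[leLHS]mulr_natl.
  by rewrite /eta mulrCA ger_pMr ?invr_gt0// ler_pdivrMr// mul1r ler_nat.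
pose K : set 'rV[R]_n := [set z | `|z| <= r / 2].
have KB z : K z -> ball 0 r z.
  rewrite /K/= -ball_normE/= sub0r normrN => h; apply: le_lt_trans h _.
  by rewrite ltr_pdivrMr// ltr_pMr// ltr1n.
have cK : closed K.
  have -> : K = (fun z : 'rV[R]_n => `|z|) @^-1` [set t : R | t <= r / 2] by [].
  by apply: closed_comp; [move=> z _; exact: norm_continuous|exact: closed_le].
(* Half of the radius [r / 2] of [K], plus [r / 4] for the value at 0, is again [r / 2]; hence [T]
   maps [K] into itself. *)
have r4 : 0 < r / 4 by rewrite divr_gt0.
have [e e0 He] : exists2 e, 0 < e & forall y, ball (psi 0) e y ->
    `|(y - psi 0) *m invmx A| < r / 4.
  apply/near_ballP.
  have c : {for psi 0, continuous (fun y : 'rV[R]_n => (y - psi 0) *m invmx A)}.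
    apply/continuous_rVP => j.
    have H : Ck_on 0 setT (fun y : 'rV[R]_n => \sum_l (y 0 l - psi 0 0 l) * invmx A l j).
      have oT := @openT 'rV[R]_n.
      apply: Ck_on_sum => // l; apply: Ck_onM => //; last exact: Ck_on_cst.
      by apply: Ck_onB => //; [exact: Ck_on_coord|exact: Ck_on_cst].
    have -> : (fun y : 'rV[R]_n => ((y - psi 0) *m invmx A) 0 j) =
        (fun y => \sum_l (y 0 l - psi 0 0 l) * invmx A l j).
      by apply/funext => y; rewrite mxE; apply: eq_bigr => l _; rewrite !mxE.
    exact: Ck_on_continuous H _.
  have /continuous_ballP/(_ _ r4) := c; rewrite subrr mul0mx.
  by apply: (filterS (F := nbhs (psi 0))) => y; rewrite -ball_normE/= sub0r normrN.
exists e => // y By.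
pose T z : 'rV[R]_n := Phi z + y *m invmx A.
have TE z : T z = z - (psi z - y) *m invmx A by rewrite /T /Phi mulmxBl opprB addrA addrAC.
have K0 : K 0 by rewrite /K/= normr0 divr_ge0// ltW.
have Tlip a b : K a -> K b -> `|T a - T b| <= 2^-1 * `|a - b|.
  move=> Ka Kb; rewrite /T opprD addrACA subrr addr0.
  by apply: lip; exact: KB.
have TK : set_fun K K T.
  move=> z Kz; rewrite /K/=; have -> : T z = (T z - T 0) + T 0 by rewrite subrK.
  apply: le_trans (ler_normD _ _) _.
  have h1 : `|T z - T 0| <= r / 4.
    apply: le_trans (Tlip _ _ Kz K0) _; rewrite subr0.
    move: Kz; rewrite /K/= => Kz; lra.
  have h2 : `|T 0| <= r / 4.
    by rewrite TE sub0r -mulNmx opprB ltW// He.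
  lra.
pose TF : {fun K >-> K} := mkfun TK.
have [|||z Kz zT] := @banach_fixed_point R 'rV[R]_n K TF.
- exists (2^-1)%:nng; split=> /=; first by rewrite invf_lt1// ltr1n.
  by move=> [a b] [/= Ka Kb]; exact: Tlip.
- by [].
- by exists 0.
exists z; first by have [] := Hr _ (KB _ Kz).
have : (psi z - y) *m invmx A = 0.
  by apply/eqP; rewrite -oppr_eq0 -(addKr z (- _)) -TE -[T z]/(TF z) -zT addNr.
move=> /(congr1 (mulmx^~ A)); rewrite mulmxKV// mul0mx => /eqP.
by rewrite subr_eq0 => /eqP.
Qed.

End LocalSurjectivity.

(** * Submanifolds obtained by restriction and as graphs *)

Section ZeroSet.
Context {R : realType}.

Lemma differentiable_sel d n (h : 'I_n -> 'I_d) (x : 'rV[R]_d) :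
  differentiable (@sel R d n h) x.
Proof.
apply: differentiable_rV => j.
exact: Ck_on_differentiable (@openT 'rV[R]_d) I (@Ck_on_sel R d n h 1 setT j).
Qed.

Lemma Ck_on_rV_differentiable m n k U (g : 'rV[R]_m -> 'rV[R]_n) x :
  open U -> U x -> (forall j, Ck_on k.+1 U (fun z => g z 0 j)) ->
  differentiable g x.
Proof.
by move=> oU Ux Hg; apply: differentiable_rV => j; exact: Ck_on_differentiable oU Ux (Hg j).
Qed.

Lemma submanifold_open d k d0 (N U : set 'rV[R]_d) :
  open U -> submanifold k d0 N -> submanifold k d0 (U `&` N).
Proof.
move=> oU HN x [Ux Nx].
have [U' [V [phi [[oU' U'0] oV [Hphi phi0] imphi [[g [gphi cg]] inj]]]]] := HN x Nx.
have cphi z : U' z -> {for z, continuous phi} by exact: Ck_on_continuous Hphi.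
have sub : [set z | U' z /\ U (phi z)] `<=` U' by move=> z [].
exists [set z | U' z /\ U (phi z)], (V `&` U), phi; split.
- by split; [exact: open_preimage_on|rewrite /= phi0].
- exact: openI.
- by split=> //; exact: Ck_on_sub Hphi.
- apply/seteqP; split=> y.
    move=> [z [U'z Uz] <-]; have : (phi @` U') (phi z) by exists z.
    by rewrite imphi => -[Nz Vz].
  move=> [[Uy Ny] [Vy _]]; have : (N `&` V) y by [].
  by rewrite -imphi => -[z U'z zy]; exists z => //; split=> //; rewrite zy.
- split=> //; exists g; split=> [z /sub/gphi//|].
  by apply: continuous_subspaceW cg; exact: image_subset.
Qed.

(** The projection [sel h] is a left inverse of [sg]: it provides both the continuous inverse of the
    chart and the injectivity of its differential. *)
Lemma submanifold_graph d n k (h : 'I_n -> 'I_d) (B : set 'rV[R]_n)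
    (sg : 'rV[R]_n -> 'rV[R]_d) (U Z : set 'rV[R]_d) :
  open B -> open U -> (forall j, Ck_on k.+1 B (fun y => sg y 0 j)) ->
  (forall y, B y -> sel h (sg y) = y) ->
  (forall x, Z x -> [/\ U x, B (sel h x) & sg (sel h x) = x]) ->
  (forall y, B y -> U (sg y) -> Z (sg y)) ->
  submanifold k.+1 n Z.
Proof.
move=> oB oU Hsg selsg ZP BZ x Zx; have [Ux Bx sgx] := ZP x Zx.
(* A chart must send 0 to [x], hence this translation before [sg]. *)
pose tr (z : 'rV[R]_n) := z + sel h x.
have tr0 : tr 0 = sel h x by rewrite /tr add0r.
have Htr l j : Ck_on l setT (fun z => tr z 0 j).
  rewrite (_ : (fun z => _) = (fun z : 'rV[R]_n => z 0 j + sel h x 0 j)).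
    by apply: Ck_onD; [exact: openT|exact: Ck_on_coord|exact: Ck_on_cst].
  by apply/funext => z; rewrite !mxE.
have ctr z : {for z, continuous tr}.
  by apply/continuous_rVP => j; exact: Ck_on_continuous (Htr 0%N j) _.
have oB' : open [set z | setT z /\ B (tr z)].
  by apply: open_preimage_on => //; exact: openT.
set B' := [set z | _] in oB'.
have Hphi j : Ck_on k.+1 B' (fun z => sg (tr z) 0 j).
  apply: (@Ck_on_comp R n n k.+1 B' B (fun y => sg y 0 j) tr) => //.
    by move=> z [].
  by move=> l; apply: Ck_on_sub (Htr k.+1 l).
have cphi z : B' z -> {for z, continuous (sg \o tr)}.
  by move=> B'z; apply/continuous_rVP => j; exact: Ck_on_continuous (Hphi j) B'z.
pose U' := [set z | B' z /\ U (sg (tr z))].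
have oU' : open U' by apply: open_preimage_on.
have U'0 : U' 0 by rewrite /U'/= /B'/= tr0 sgx.
exists U', U, (sg \o tr); split=> //.
- split; last by rewrite /= tr0.
  by apply/Ck_on_rVP => // j; apply: Ck_on_sub (Hphi j) => z [].
- apply/seteqP; split=> y.
    by move=> [z [[_ Bz] Uz] <-]; split=> //; exact: BZ.
  move=> [Zy Uy]; have [_ By sgy] := ZP y Zy.
  have E : tr (sel h y - sel h x) = sel h y by rewrite /tr subrK.
  exists (sel h y - sel h x); last by rewrite /= E.
  by rewrite /U'/= /B'/= E sgy.
- split.
    exists (fun y => sel h y - sel h x); split.
      by move=> z [[_ Bz] _]; rewrite /= selsg// /tr addrK.
    apply: continuous_subspaceT => y; apply: continuousB.
      exact: sel_continuous.
    exact: cst_continuous.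
  have dtr z : differentiable tr z.
    by apply: (@Ck_on_rV_differentiable _ _ 0 setT) => //; exact: openT.
  apply: (@injective_diff R _ _ _ (sg \o tr) (@sel R d n h) tr) => //.
  + by apply: Ck_on_rV_differentiable oU' U'0 _ => j; apply: Ck_on_sub (Hphi j) => z [].
  + exact: differentiable_sel.
  + by apply: (open_near oU' U'0) => z [[_ Bz] _]; rewrite /= selsg.
  + have E v : 'd tr 0 v = v.
      rewrite -deriveE// -[tr]/(id + cst (sel h x)) deriveD.
      * by rewrite derive_id derive_cst addr0.
      * exact: derivable_id.
      * exact: derivable_cst.
    by move=> v w; rewrite !E.
Qed.

End ZeroSet.

(** * Comparison of [N] with the graph of the normal form *)

Theorem theorem2p3 (R : realType) (d p k d0 : nat) (x0 : 'rV[R]_d)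
  (W : set 'rV[R]_d) (f : 'rV[R]_d -> R) :
  (2 <= p)%N -> (1 <= k)%N ->
  open W -> W x0 -> Ck_on p W f -> (forall x, W x -> 0 <= f x) -> f x0 = 0 ->
  (exists N : set 'rV[R]_d,
      [/\ submanifold k d0 N, N x0,
          N `<=` [set x | W x /\ f x = 0] &
          \rank (hessian f x0) = (d - d0)%N]) ->
  exists U : set 'rV[R]_d,
    [/\ open U, U x0, U `<=` W,
        submanifold (maxn k p.-1) d0 (U `&` [set x | W x /\ f x = 0]) &
        exists fs : 'I_(d - d0) -> 'rV[R]_d -> R,
          (forall i, Ck_on (p - 2) U (fs i)) /\
          (forall x, U x -> f x = \sum_(i < d - d0) fs i x ^+ 2)].
Proof.
(* From here [p] is [m.+2], so the classes [p - 1] and [p - 2] are [m.+1] and [m], and [k.+1] stands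
   for the given [k]. *)
case: p => [|[|m]]// _; case: k => [//|k] _ oW Wx0 Hf f0 fx0 [N [HN Nx0 NZ rk]].
have [U' [V [phi [[oU' U'0] oV [Hphi phi0] imphi [_ inj]]]]] := HN x0 Nx0.
have Hphi1 j : Ck_on 1 U' (fun z => phi z 0 j).
  by apply: (Ck_on_rVP _ _ oU').1; exact: Ck_onW Hphi.
have dphi : differentiable phi 0 by exact: Ck_on_rV_differentiable oU' U'0 Hphi1.
(* As [d - d0] is truncated, this bound is what turns [n + (d - d0) = d] into [n = d0]. *)
have d0d : (d0 <= d)%N.
  have /eqP <- := row_free_jacobian dphi inj; exact: rank_leq_col.
have [n [h [U [B [sg [fs [nE [oU Ux0 UW] [oB hB] [Hsg sgP] [Hfs fE fZ]]]]]]]] :=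
  normal_form oW Wx0 Hf f0 fx0 rk.
have {}nE : n = d0 by lia.
subst n.
have phiN z : U' z -> N (phi z).
  by move=> U'z; have : (phi @` U') (phi z) by [exists z]; rewrite imphi => -[].
have fphi z : U' z -> f (phi z) = 0 by move=> /phiN/NZ[].
pose O := [set z | U' z /\ U (phi z)].
have oO : open O.
  by apply: open_preimage_on => // z; exact: Ck_on_continuous Hphi.
have O0 : O 0 by rewrite /O/= phi0.
(* The chart of [N] projected to the surviving coordinates: a map between spaces of equal dimension
   [d0]. *)
pose psi z := sel h (phi z).
have sgpsi z : O z -> sg (psi z) = phi z.
  by move=> [U'z Uz]; rewrite /psi -fZ// fphi.
have Hpsi j : Ck_on 1 O (fun z => psi z 0 j).
  rewrite (_ : (fun z => _) = (fun z => phi z 0 (h j))).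
    by apply: Ck_on_sub (Hphi1 (h j)) => z [].
  by apply/funext => z; rewrite mxE.
have dpsi : differentiable psi 0 by exact: Ck_on_rV_differentiable oO O0 Hpsi.
have Bpsi0 : B (psi 0) by rewrite /psi phi0; exact: hB.
(* Near 0 the chart is [sg \o psi], because zeros of [f] lie on the graph of [sg]; injectivity
   passes from [phi] to [psi]. *)
have injpsi : injective ('d psi 0).
  apply: (@injective_diff R _ _ _ psi sg phi) => //.
    exact: Ck_on_rV_differentiable oB Bpsi0 Hsg.
  exact: (open_near oO O0).
have [e e0 He] := local_surjection oO O0 Hpsi injpsi.
(* The projection of [N] covers this ball, so over it the graph of [sg] lies in [N] and the
   remaining function is zero. *)
have fsg y : ball (psi 0) e y -> f (sg y) = 0 /\ N (sg y).
  by move=> /He[z Oz <-]; rewrite sgpsi//; case: Oz => U'z _; split; [exact: fphi|exact: phiN].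
pose U2 := [set x | U x /\ ball (psi 0) e (sel h x)].
have oU2 : open U2.
  by apply: open_preimage_on => //; [exact: ball_open|move=> z _; exact: sel_continuous].
have U2x0 : U2 x0 by split=> //; rewrite /psi phi0; exact: ballxx.
have U2W : U2 `<=` W by move=> x [/UW].
exists U2; split=> //; last first.
  exists fs; split=> [i|x [Ux Bx]].
    by rewrite subn2; apply: Ck_on_sub (Hfs i) => x [].
  by rewrite fE//; have [-> _] := fsg _ Bx; rewrite add0r.
have ZE : U2 `&` [set x | W x /\ f x = 0] = U2 `&` N.
  apply/seteqP; split=> x [U2x]; last by move=> /NZ.
  move=> [Wx fx]; split=> //; have [Ux Bx] := U2x.
  by rewrite (fZ _ Ux fx); have [] := fsg _ Bx.
(* The zero set has two descriptions: as the graph of [sg] it has class [m.+1], as a piece of [N]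
   class [k.+1]. The larger of the two decides which one is used. *)
case: (leqP k.+1 m.+1) => km; rewrite /= ?(maxn_idPr km) ?(maxn_idPl (ltnW km)).
  apply: (@submanifold_graph R d d0 m h (B `&` ball (psi 0) e) sg U2) => //.
  - by apply: openI => //; exact: ball_open.
  - by move=> j; apply: Ck_on_sub (Hsg j) => y [].
  - by move=> y [/sgP[]].
  - move=> x [U2x [Wx fx]]; have [Ux Bx] := U2x.
    by split=> //; [split=> //; exact: hB|rewrite -fZ].
  - move=> y [By ey] U2y; split=> //; split; first exact: U2W.
    by have [] := fsg _ ey.
by rewrite ZE; exact: submanifold_open.
Qed.
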